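(* The restriction of coefficients morphism for Drinfeld modules is in general not relatively representable. That is: there exist a finite field $\mathbb{F}_q$, smooth projective geometrically irreducible curves $C,C'$ over $\mathbb{F}_q$, a finite morphism $\pi:C'\to C$ of some degree $n$, a closed point $\infty\in C$ with exactly one point $\infty'\in C'$ above it, and a positive integer $r'$, such that the morphism of functors $\pi_*:\underline{\mathrm{Dr}\text{-}A'\text{-}\mathrm{Mod}}^{r'}\to\underline{\mathrm{Dr}\text{-}A\text{-}\mathrm{Mod}}^{nr'}$, $(E',\varphi')\mapsto(E',\varphi'\circ\pi^* )$, is not relatively representable, where $A=\Gamma(C\setminus\{\infty\},\mathcal{O}_C)$ and $A'=\Gamma(C'\setminus\{\infty'\},\mathcal{O}_{C'})$.
   Context: Let $\pi:C'\to C$ be a finite morphism of degree $n$ between smooth projective geometrically irreducible curves over $\mathbb{F}_q$, $\infty\in C$ a closed point with exactly one point $\infty'\in C'$ above it, $A:=\Gamma(C\setminus\{\infty\},\mathcal{O}_C)$, $A':=\Gamma(C'\setminus\{\infty'\},\mathcal{O}_{C'})$; $A'$ is a flat $A$-algebra via $\pi^*:A\to A'$. Put $\deg(\infty):=[\kappa(\infty):\mathbb{F}_q]$ and let $\mathrm{ord}_\infty$ be the normalized valuation on $\mathrm{Frac}(A)$ at $\infty$ (similarly for $A'$, $\infty'$). For an $\mathbb{F}_q$-algebra $B$, $B\{\tau\}$ is the non-commutative polynomial ring with $\tau b=b^q\tau$ for $b\in B$; it is identified with the ring of $\mathbb{F}_q$-linear endomorphisms of $\mathbb{G}_{a,B}$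 by sending $\tau$ to the $q$-th power Frobenius. Drinfeld module: let $S$ be an $\mathbb{F}_q$-scheme with a morphism $c:S\to\operatorname{Spec}A$, and $r$ a positive integer. A Drinfeld-$A$-module of rank $r$ and characteristic $c$ over $S$ is a pair $(E,\varphi)$ of a commutative group scheme $E$ over $S$ and a ring homomorphism $\varphi:A\to\operatorname{End}_S(E)$ (endomorphisms of the $S$-group scheme) such that (1) Zariski locally on $S$, $E$ is isomorphic to $\mathbb{G}_{a,S}$ ($\mathbb{F}_q$-linearly, where $\mathbb{F}_q\subset A$ acts on $E$ via $\varphi$ and on $\mathbb{G}_a$ by scalars); (2) if $U=\operatorname{Spec}B\subset S$ is affine open and $\psi:E_U\to\mathbb{G}_{a,U}$ is an ($\mathbb{F}_q$-linear) isomorphism of group schemes, then for each $a\in A\setminus\{0\}$ one has $\psi\circ\varphi(a)\circ\psi^{-1}=\sum_{i=0}^{<\infty}\delta_i(a)\tau^i\in B\{\tau\}$ with $\delta_0(a)=c^*(a)$, $\delta_i(a)\in B^\times$ for $i=d(a):=-r\,\mathrm{ord}_\infty(a)\deg(\infty)$, and $\delta_i(a)$ nilpotent for $i>d(a)$. A morphism $(E,\varphi)\to(\widetilde E,\widetilde\varphi)$ is a morphism $\epsilon:E\to\widetilde E$ of $S$-group schemes with $\widetilde\varphi(a)\circ\epsilon=\epsilon\circ\varphi(a)$ for all $a\in A$. Drinfeld-$A'$-modules are defined in the same way with $(C',\infty',A')$. $\underline{\mathrm{Dr}\text{-}A\text{-}\mathrm{Mod}}^{r}$ is the contravariant functor from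 schemes over $\operatorname{Spec}A$ to sets sending $c:S\to\operatorname{Spec}A$ to the set of isomorphism classes of Drinfeld-$A$-modules of rank $r$ and characteristic $c$ over $S$. If $(E',\varphi')$ is a Drinfeld-$A'$-module of rank $r'$ and characteristic $c'$ over $S$, then $\pi_*(E',\varphi'):=(E',\varphi'\circ\pi^* )$ is a Drinfeld-$A$-module of rank $nr'$ and characteristic $\pi\circ c'$. ''$\pi_*$ is relatively representable'' means: for every scheme $c:S\to\operatorname{Spec}A$ and every Drinfeld-$A$-module $(E,\varphi)$ of rank $nr'$ and characteristic $c$ over $S$, the fiber product functor on schemes over $\operatorname{Spec}A'\times_{\operatorname{Spec}A}S$, sending $(c':S'\to\operatorname{Spec}A',\,f:S'\to S)$ to the set of isomorphism classes of Drinfeld-$A'$-modules $(E',\varphi')$ of rank $r'$ and characteristic $c'$ over $S'$ for which there exists an isomorphism $f^*(E,\varphi)\cong\pi_*(E',\varphi')$, is representable by a scheme. *)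

(* Defs.v *)
(* Schemes are functors of points in the sense of Demazure-Gabriel, "Groupes
   algebriques" I.1, and Jantzen, "Representations of algebraic groups" I.1:
   a scheme is a functor from commutative rings to sets that is a sheaf for the
   Zariski topology and has a covering by open subfunctors isomorphic to
   functors Sp B.  This category is equivalent to that of schemes as locally
   ringed spaces, Sp B corresponding to Spec B and natural transformations to
   morphisms of schemes.

   Rings are comPzRingTypes, so that the zero ring is among the test rings. *)

From HB Require Import structures.
From mathcomp Require Import all_boot all_order all_algebra.
From mathcomp Require Import boolp.

Set Implicit Arguments.
Unset Strict Implicit.
Unset Printing Implicit Defensive.
Import GRing.Theory.
Local Open Scope ring_scope.
Local Obligation Tactic := idtac.

Lemma rmorph_ext (R S : pzRingType) (f g : {rmorphism R -> S}) :
  f =1 g -> f = g.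
Proof.
case: f g => f [[fA] [fM]] [g [[gA] [gM]]] /= efg.
have {}efg : f = g by apply/funext.
case: _ / efg gA gM => gA gM.
by rewrite (Prop_irrelevance fA gA) (Prop_irrelevance fM gM).
Qed.

Definition rid (R : pzRingType) : {rmorphism R -> R} := idfun.

Definition rcomp (R S T : pzRingType) (g : {rmorphism S -> T})
  (f : {rmorphism R -> S}) : {rmorphism R -> T} := g \o f.

Lemma sig_ext (T : Type) (P : T -> Prop) (x y : {t | P t}) :
  sval x = sval y -> x = y.
Proof. by case: x y => x px [y py] /= e; apply: eq_exist. Qed.

Record functor := Functor {
  ob :> comPzRingType -> Type;
  fmap : forall R S : comPzRingType, {rmorphism R -> S} -> ob R -> ob S;
  fmap_id : forall R (x : ob R), fmap (rid R) x = x;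
  fmap_comp : forall (R S T : comPzRingType) (f : {rmorphism R -> S})
    (g : {rmorphism S -> T}) (x : ob R),
    fmap (rcomp g f) x = fmap g (fmap f x) }.

Arguments fmap X {R S} f x : rename.

Record mor (X Y : functor) := Mor {
  app :> forall R : comPzRingType, X R -> Y R;
  app_nat : forall (R S : comPzRingType) (f : {rmorphism R -> S}) (x : X R),
    app (fmap X f x) = fmap Y f (app x) }.

Arguments app {X Y} m {R} x.

Definition mor_eq (X Y : functor) (f g : mor X Y) : Prop :=
  forall (R : comPzRingType) (x : X R), f R x = g R x.

Definition is_iso (X Y : functor) (f : mor X Y) : Prop :=
  forall R : comPzRingType, bijective (@app _ _ f R).

Program Definition comp (X Y Z : functor) (g : mor Y Z) (f : mor X Y) :
  mor X Z := @Mor X Z (fun R x => g R (f R x)) _.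
Next Obligation. by move=> *; rewrite /= !app_nat. Qed.

Program Definition Sp (A : comPzRingType) : functor :=
  @Functor (fun R => {rmorphism A -> R}) (fun R S f x => rcomp f x) _ _.
Next Obligation. by move=> *; apply: rmorph_ext. Qed.
Next Obligation. by move=> *; apply: rmorph_ext. Qed.

Program Definition A1 : functor :=
  @Functor (fun R => R) (fun R S f x => f x) _ _.
Next Obligation. by []. Qed.
Next Obligation. by []. Qed.

(* The morphism Sp R -> X that corresponds to x in X(R) by Yoneda's lemma. *)
Program Definition point_mor (X : functor) (R : comPzRingType) (x : X R) :
  mor (Sp R) X := @Mor (Sp R) X (fun S f => fmap X f x) _.
Next Obligation. by move=> *; rewrite /= fmap_comp. Qed.

Definition Sp_mor (A B : comPzRingType) (f : {rmorphism A -> B}) :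
  mor (Sp B) (Sp A) := @point_mor (Sp A) B f.

Program Definition fprod (X Y S : functor) (f : mor X S) (g : mor Y S) :
  functor :=
  @Functor (fun R => {z : X R * Y R | f R z.1 = g R z.2})
    (fun R T h z =>
       exist _ (fmap X h (sval z).1, fmap Y h (sval z).2) _) _ _.
Next Obligation. by move=> X Y S f g R T h [z e]; rewrite /= !app_nat e. Qed.
Next Obligation.
by move=> X Y S f g R [[x y] e]; apply: sig_ext; rewrite /= !fmap_id.
Qed.
Next Obligation. by move=> *; apply: sig_ext; rewrite /= !fmap_comp. Qed.

Definition fst_mor (X Y S : functor) (f : mor X S) (g : mor Y S) :
  mor (fprod f g) X :=
  @Mor (fprod f g) X (fun R z => (sval z).1) (fun _ _ _ _ => erefl).

Definition snd_mor (X Y S : functor) (f : mor X S) (g : mor Y S) :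
  mor (fprod f g) Y :=
  @Mor (fprod f g) Y (fun R z => (sval z).2) (fun _ _ _ _ => erefl).

Program Definition prod_fun (X Y : functor) : functor :=
  @Functor (fun R => (X R * Y R)%type)
    (fun R T h z => (fmap X h z.1, fmap Y h z.2)) _ _.
Next Obligation. by move=> X Y R [x y]; rewrite /= !fmap_id. Qed.
Next Obligation. by move=> *; rewrite /= !fmap_comp. Qed.

Program Definition pair_mor (Z X Y : functor) (f : mor Z X) (g : mor Z Y) :
  mor Z (prod_fun X Y) :=
  @Mor Z (prod_fun X Y) (fun R z => (f R z, g R z)) _.
Next Obligation. by move=> *; rewrite /= !app_nat. Qed.

Definition subset_of (X : functor) := forall R : comPzRingType, X R -> Prop.

Definition stable (X : functor) (U : subset_of X) : Prop :=
  forall (R S : comPzRingType) (f : {rmorphism R -> S}) (x : X R),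
    U R x -> U S (fmap X f x).

Program Definition sub_fun (X : functor) (U : subset_of X) (hU : stable U) :
  functor :=
  @Functor (fun R => {x : X R | U R x})
    (fun R S f x => exist _ (fmap X f (sval x)) _) _ _.
Next Obligation. by move=> X U hU R S f [x ux]; apply: hU. Qed.
Next Obligation. by move=> *; apply: sig_ext; rewrite /= fmap_id. Qed.
Next Obligation. by move=> *; apply: sig_ext; rewrite /= fmap_comp. Qed.

Definition unit_ideal (R : comPzRingType) (I : R -> Prop) : Prop :=
  exists (n : nat) (a b : 'I_n -> R),
    (forall i, I (a i)) /\ \sum_(i < n) a i * b i = 1.

(* The inverse image of U under each x : Sp R -> X is the open D(I), i.e. the
   set of those f : R -> S with f(I)S = S. *)
Definition is_open (X : functor) (U : subset_of X) : Prop :=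
  stable U /\
  forall (R : comPzRingType) (x : X R), exists I : R -> Prop,
  forall (S : comPzRingType) (f : {rmorphism R -> S}),
    U S (fmap X f x) <-> unit_ideal (fun s => exists2 a, I a & s = f a).

Definition is_closed (X : functor) (Z : subset_of X) : Prop :=
  stable Z /\
  forall (R : comPzRingType) (x : X R), exists I : R -> Prop,
  forall (S : comPzRingType) (f : {rmorphism R -> S}),
    Z S (fmap X f x) <-> (forall a, I a -> f a = 0).

Definition image (X Y : functor) (f : mor X Y) : subset_of Y :=
  fun R y => exists x : X R, f R x = y.

Definition open_immersion (X Y : functor) (f : mor X Y) : Prop :=
  (forall R : comPzRingType, injective (@app _ _ f R)) /\ is_open (image f).

Definition closed_immersion (X Y : functor) (f : mor X Y) : Prop :=
  (forall R : comPzRingType, injective (@app _ _ f R)) /\ is_closed (image f).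

Definition open_cover (X : functor) (I : Type) (U : I -> functor)
    (u : forall i, mor (U i) X) : Prop :=
  (forall i, open_immersion (u i)) /\
  (forall (K : fieldType) (x : X K), exists i, image (u i) x).

(* The open complement of a closed subfunctor Z: its points over R are those x
   for which the inverse image of Z in Sp R is empty. *)
Definition compl (X : functor) (Z : subset_of X) : subset_of X :=
  fun R x => forall (S : comPzRingType) (f : {rmorphism R -> S}),
    Z S (fmap X f x) -> (1 : S) = 0.

Lemma compl_stable (X : functor) (Z : subset_of X) : stable (compl Z).
Proof. by move=> R S f x h T g; rewrite -fmap_comp; apply: h. Qed.

(* l : R -> L is the localization of R at the powers of s. *)
Definition is_localization (R L : comPzRingType) (l : {rmorphism R -> L})
    (s : R) : Prop :=
  [/\ exists t, l s * t = 1,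
      forall y : L, exists a k, l s ^+ k * y = l a
    & forall a : R, l a = 0 -> exists k, s ^+ k * a = 0].

(* The sheaf axiom for the coverings of Sp R by the D(s_i). *)
Definition zariski_sheaf (X : functor) : Prop :=
  forall (R : comPzRingType) (n : nat) (s : 'I_n -> R)
    (L : 'I_n -> comPzRingType) (l : forall i, {rmorphism R -> L i}),
  unit_ideal (fun a => exists i, a = s i) ->
  (forall i, is_localization (l i) (s i)) ->
  forall x : (forall i, X (L i)),
  (forall i j (T : comPzRingType) (g : {rmorphism L i -> T})
     (h : {rmorphism L j -> T}), rcomp g (l i) = rcomp h (l j) ->
     fmap X g (x i) = fmap X h (x j)) ->
  exists! y : X R, forall i, fmap X (l i) y = x i.

Definition is_scheme (X : functor) : Prop :=
  zariski_sheaf X /\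
  exists (I : Type) (B : I -> comPzRingType) (u : forall i, mor (Sp (B i)) X),
    open_cover u.

Definition finite_type_alg (k B : comPzRingType) (rho : {rmorphism k -> B}) :
  Prop :=
  exists (n : nat) (x : 'I_n -> B), forall P : B -> Prop,
    (forall a, P (rho a)) -> (forall i, P (x i)) ->
    (forall b b', P b -> P b' -> P (b + b')) ->
    (forall b b', P b -> P b' -> P (b * b')) ->
    forall b, P b.

(* In this and the following definitions c : X -> Sp k makes X a k-scheme. *)
Definition locally_finite_type (k : comPzRingType) (X : functor)
    (c : mor X (Sp k)) : Prop :=
  exists (I : Type) (B : I -> comPzRingType) (u : forall i, mor (Sp (B i)) X),
    open_cover u /\
    forall i, finite_type_alg (c (B i) (u i (B i) (rid (B i)))).

Definition formally_smooth (k : comPzRingType) (X : functor)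
    (c : mor X (Sp k)) : Prop :=
  forall (R R0 : comPzRingType) (f : {rmorphism R -> R0}),
  (forall y, exists a, f a = y) ->
  (forall a b, f a = 0 -> f b = 0 -> a * b = 0) ->
  forall (rho : {rmorphism k -> R}) (x0 : X R0),
  c R0 x0 = rcomp f rho ->
  exists x : X R, fmap X f x = x0 /\ c R x = rho.

(* Used only over fields, where locally of finite type is the same as locally
   of finite presentation. *)
Definition smooth (k : comPzRingType) (X : functor) (c : mor X (Sp k)) : Prop :=
  locally_finite_type c /\ formally_smooth c.

(* The direct summands of rank 1 of R^(N+1).  A direct summand is the row space
   of an idempotent matrix e. *)
Definition line (N : nat) (R : comPzRingType) (L : 'rV[R]_N.+1 -> Prop) : Prop :=
  exists e : 'M[R]_N.+1,
    [/\ e *m e = e, forall v, L v <-> v *m e = v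
      & forall (K : fieldType) (f : {rmorphism R -> K}),
          \rank (map_mx f e) = 1%N].

Definition span_image (N : nat) (R S : comPzRingType) (f : {rmorphism R -> S})
    (L : 'rV[R]_N.+1 -> Prop) : 'rV[S]_N.+1 -> Prop :=
  fun w => exists (m : nat) (a : 'I_m -> S) (v : 'I_m -> 'rV[R]_N.+1),
    (forall i, L (v i)) /\ w = \sum_(i < m) a i *: map_mx f (v i).

Lemma span_imageE (N : nat) (R S : comPzRingType) (f : {rmorphism R -> S})
    (L : 'rV[R]_N.+1 -> Prop) (e : 'M[R]_N.+1) :
  e *m e = e -> (forall v, L v <-> v *m e = v) ->
  forall w, span_image f L w <-> w *m map_mx f e = w.
Proof.
move=> ee Le w; split=> [[m [a [v [Lv ->]]]]|<-].
  rewrite mulmx_suml; apply: eq_bigr => i _.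
  by rewrite -scalemxAl -map_mxM; congr (_ *: map_mx f _); apply/Le.
exists N.+1, (fun i => w 0 i), (fun i => row i e); split=> [i|].
  by apply/Le; rewrite -row_mul ee.
by rewrite mulmx_sum_row; apply: eq_bigr => i _; rewrite map_row.
Qed.

Program Definition PN (N : nat) : functor :=
  @Functor (fun R => {L : 'rV[R]_N.+1 -> Prop | line L})
    (fun R S f L => exist _ (span_image f (sval L)) _) _ _.
Next Obligation.
move=> N R S f [L [e [ee Le re]]]; exists (map_mx f e); split.
- by rewrite -map_mxM ee.
- exact: span_imageE.
by move=> K g; rewrite -map_mx_comp; apply: (re K (rcomp g f)).
Qed.
Next Obligation.
move=> N R [L [e [ee Le re]]]; apply: sig_ext => /=.
apply/funext => v; apply/propext.
by rewrite (span_imageE (rid R) ee Le) map_mx_id // Le.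
Qed.
Next Obligation.
move=> N R S T f g [L [e [ee Le re]]]; apply: sig_ext => /=.
apply/funext => v; apply/propext.
rewrite (span_imageE (rcomp g f) ee Le).
have ee' : map_mx f e *m map_mx f e = map_mx f e by rewrite -map_mxM ee.
by rewrite (span_imageE g ee' (span_imageE f ee Le)) -map_mx_comp.
Qed.

Definition projective (k : comPzRingType) (X : functor) (c : mor X (Sp k)) :
  Prop :=
  exists (N : nat) (j : mor X (PN N)), closed_immersion (pair_mor j c).

(* The points of the underlying space of X are represented by pairs of a field
   K and an element of X(K), and its open subsets correspond to the open
   subfunctors of X.  A set of points is given by the pairs representing its
   elements. *)
Definition point_set (X : functor) := forall K : fieldType, X K -> Prop.

Definition inhabited_set (X : functor) (Z : point_set X) : Prop :=
  exists (K : fieldType) (x : X K), Z K x.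

Definition closed_set (X : functor) (Z : point_set X) : Prop :=
  exists U : subset_of X, is_open U /\ forall K x, Z K x <-> ~ U K x.

Definition irreducible_set (X : functor) (Z : point_set X) : Prop :=
  inhabited_set Z /\
  forall U V : subset_of X, is_open U -> is_open V ->
    inhabited_set (fun K x => Z K x /\ U K x) ->
    inhabited_set (fun K x => Z K x /\ V K x) ->
    inhabited_set (fun K x => [/\ Z K x, U K x & V K x]).

Definition irreducible (X : functor) : Prop :=
  irreducible_set (fun (K : fieldType) (x : X K) => True).

Definition has_chain (X : functor) (d : nat) : Prop :=
  exists Z : nat -> point_set X,
    (forall i, (i <= d)%N -> closed_set (Z i) /\ irreducible_set (Z i)) /\
    (forall i, (i < d)%N ->
       (forall K x, Z i K x -> Z i.+1 K x) /\
       inhabited_set (fun K x => Z i.+1 K x /\ ~ Z i K x)).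

Definition has_dimension (X : functor) (d : nat) : Prop :=
  has_chain X d /\ ~ has_chain X d.+1.

Definition geometrically_irreducible (k : fieldType) (X : functor)
    (c : mor X (Sp k)) : Prop :=
  forall (K : fieldType) (i : {rmorphism k -> K}), irreducible (fprod c (Sp_mor i)).

(* S is a free R-module of rank n via h. *)
Definition free_of_rank (R S : comPzRingType) (h : {rmorphism R -> S}) (n : nat) :
  Prop :=
  exists e : 'I_n -> S, forall y : S,
    exists! a : 'rV[R]_n, y = \sum_(i < n) h (a 0 i) * e i.

Record curve (k : fieldType) := Curve {
  crv :> functor;
  str : mor crv (Sp k);
  crv_scheme : is_scheme crv;
  crv_dim : has_dimension crv 1;
  crv_smooth : smooth str;
  crv_proj : projective str;
  crv_geom_irr : geometrically_irreducible str }.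

Fixpoint ideal_pow (B : comPzRingType) (m : B -> Prop) (i : nat) : B -> Prop :=
  if i is i'.+1 then fun b =>
    exists (N : nat) (x y : 'I_N -> B),
      (forall j, m (x j) /\ ideal_pow m i' (y j)) /\ b = \sum_(j < N) x j * y j
  else fun=> True.

(* If B is the ring of an affine open set and m the maximal ideal of a regular
   point of a curve, this is the valuation of b at that point. *)
Definition adic_order (B : comPzRingType) (m : B -> Prop) (b : B) (i : nat) :
  Prop := ideal_pow m i b /\ ~ ideal_pow m i.+1 b.

(* A closed point of X with residue field kappa is a closed immersion
   pt : Sp kappa -> X. *)
Definition off (X : functor) (kappa : fieldType) (pt : mor (Sp kappa) X) :
  functor := sub_fun (@compl_stable X (image pt)).

(* The function g on X minus pt has order o at pt: in an affine open
   neighbourhood Sp B of pt, with m the maximal ideal of pt, it is a quotient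
   b1 / b2 where b1 and b2 have m-adic orders i1 and i2, and o = i1 - i2. *)
Definition has_order (X : functor) (kappa : fieldType) (pt : mor (Sp kappa) X)
    (g : mor (off pt) A1) (o : int) : Prop :=
  exists (B : comPzRingType) (u : mor (Sp B) X) (e : {rmorphism B -> kappa})
    (b1 b2 : B) (i1 i2 : nat),
    [/\ open_immersion u, u kappa e = pt kappa (rid kappa),
        adic_order (fun b => e b = 0) b1 i1 /\
        adic_order (fun b => e b = 0) b2 i2,
        forall (R : comPzRingType) (h : {rmorphism B -> R})
          (hu : compl (image pt) (u R h)),
          h b2 * g R (exist _ (u R h) hu) = h b1
      & o = i1%:Z - i2%:Z].

(* A curve over k with a closed point infty of residue field kappa.  The fields
   after infty_closed are determined by these up to isomorphism (except for the
   value of ord at 0, which is not used): cring is the ring of functions on C minus infty, given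
   by a bijection cfun compatible with the ring operations, kring its k-algebra
   structure, deg = [kappa : k], and ord the normalized valuation at infty. *)
Record pointed_curve (k : fieldType) := PointedCurve {
  pcurve :> curve k;
  kappa : fieldType;
  infty : mor (Sp kappa) pcurve;
  infty_closed : closed_immersion infty;
  deg : nat;
  degP : free_of_rank (str pcurve kappa (infty kappa (rid kappa))) deg;
  cring : comPzRingType;
  cfun : cring -> mor (off infty) A1;
  cfun1 : forall R x, cfun 1 R x = 1;
  cfunD : forall a b R x, cfun (a + b) R x = cfun a R x + cfun b R x;
  cfunM : forall a b R x, cfun (a * b) R x = cfun a R x * cfun b R x;
  cfun_inj : forall a b, mor_eq (cfun a) (cfun b) -> a = b;
  cfun_surj : forall g : mor (off infty) A1, exists a, mor_eq (cfun a) g;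
  kring : {rmorphism k -> cring};
  kringP : forall l R x, cfun (kring l) R x = str pcurve R (sval x) l;
  ord : cring -> int;
  ordP : forall a, a != 0 -> has_order (cfun a) (ord a) }.

Section Morphisms.
Variables (k : fieldType) (C' C : pointed_curve k) (pi : mor C' C).

Definition over_base : Prop := mor_eq (comp (str C) pi) (str C').

Definition finite_mor : Prop :=
  exists (I : Type) (B B' : I -> comPzRingType)
    (u : forall i, mor (Sp (B i)) C) (u' : forall i, mor (Sp (B' i)) C')
    (h : forall i, {rmorphism B i -> B' i}),
    [/\ open_cover u, forall i, open_immersion (u' i),
        forall i (R : comPzRingType) (x : C' R),
          image (u' i) x <-> image (u i) (pi R x),
        forall i, mor_eq (comp pi (u' i)) (comp (u i) (Sp_mor (h i)))
      & forall i, exists (m : nat) (e : 'I_m -> B' i), forall y, exists a,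
          y = \sum_(j < m) h i (a j) * e j].

(* pi has degree n at the generic point of C: the fibre of pi over every K-point
   of C lying over the generic point is the spectrum of a K-algebra of
   dimension n. *)
Definition degree_is (n : nat) : Prop :=
  forall (K : fieldType) (x : C K),
  (forall U : subset_of C, is_open U ->
     inhabited_set (fun L y => U L y) -> U K x) ->
  exists (K' : comPzRingType) (h : {rmorphism K -> K'})
    (j : mor (Sp K') (fprod pi (point_mor x))),
    [/\ is_iso j, mor_eq (comp (snd_mor pi (point_mor x)) j) (Sp_mor h)
      & free_of_rank h n].

(* The only point of C' above infty is infty'. *)
Definition one_point_above : Prop :=
  forall (K : fieldType) (x : C' K),
    image (infty C) (pi K x) <-> image (infty C') x.

Definition is_pullback_of_functions (pis : {rmorphism cring C -> cring C'}) :
  Prop :=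
  forall (a : cring C) (R : comPzRingType) (x : C' R)
    (hx : compl (image (infty C')) x) (hpx : compl (image (infty C)) (pi R x)),
    cfun (pis a) R (exist _ x hx) = cfun a R (exist _ (pi R x) hpx).

End Morphisms.

Record comm_group (S : functor) := CommGroup {
  gob :> functor;
  gpr : mor gob S;
  gadd : forall (R : comPzRingType) (x y : gob R), gpr R x = gpr R y -> gob R;
  gzero : mor S gob;
  gopp : mor gob gob;
  gadd_nat : forall (R T : comPzRingType) (f : {rmorphism R -> T})
    (x y : gob R) (e : gpr R x = gpr R y)
    (e' : gpr T (fmap gob f x) = gpr T (fmap gob f y)),
    fmap gob f (gadd e) = gadd e';
  gpr_add : forall R (x y : gob R) (e : gpr R x = gpr R y),
    gpr R (gadd e) = gpr R x;
  gpr_zero : forall R (s : S R), gpr R (gzero R s) = s;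
  gpr_opp : forall R (x : gob R), gpr R (gopp R x) = gpr R x;
  gaddA : forall R (x y z : gob R) (exy : gpr R x = gpr R y)
    (eyz : gpr R y = gpr R z) (e1 : gpr R (gadd exy) = gpr R z)
    (e2 : gpr R x = gpr R (gadd eyz)), gadd e1 = gadd e2;
  gaddC : forall R (x y : gob R) (e : gpr R x = gpr R y)
    (e' : gpr R y = gpr R x), gadd e = gadd e';
  gadd0 : forall R (x : gob R) (e : gpr R (gzero R (gpr R x)) = gpr R x),
    gadd e = x;
  gaddN : forall R (x : gob R) (e : gpr R (gopp R x) = gpr R x),
    gadd e = gzero R (gpr R x) }.

Arguments gadd {S} G {R x y} e : rename.
Arguments gpr {S} G : rename.

Definition is_group_mor (S : functor) (E F : comm_group S) (eps : mor E F) :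
  Prop :=
  mor_eq (comp (gpr F) eps) (gpr E) /\
  forall (R : comPzRingType) (x y : E R) (e : gpr E R x = gpr E R y)
    (e' : gpr F R (eps R x) = gpr F R (eps R y)),
    eps R (gadd E e) = gadd F e'.

(* A pair (E, phi) of a commutative group functor E over S and a ring
   homomorphism phi from A to the endomorphism ring of E. *)
Record amodule (A : comPzRingType) (S : functor) := AModule {
  grp :> comm_group S;
  act : A -> mor grp grp;
  act_mor : forall a, is_group_mor (act a);
  act1 : forall R (x : grp R), act 1 R x = x;
  actM : forall a b R (x : grp R), act (a * b) R x = act a R (act b R x);
  actD : forall a b R (x : grp R)
    (e : gpr grp R (act a R x) = gpr grp R (act b R x)),
    act (a + b) R x = gadd grp e }.

Definition amodule_iso (A : comPzRingType) (S : functor) (M N : amodule A S) :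
  Prop :=
  exists eps : mor M N,
    [/\ is_group_mor eps, is_iso eps
      & forall a, mor_eq (comp (act N a) eps) (comp eps (act M a))].

Section Pullback.
Variables (S S' : functor) (f : mor S' S).

Program Definition pull_group (E : comm_group S) : comm_group S' :=
  @CommGroup S' (fprod (gpr E) f) (snd_mor (gpr E) f)
    (fun R x y e => exist _ (@gadd S E R (sval x).1 (sval y).1 _, (sval x).2) _)
    (@Mor S' (fprod (gpr E) f)
       (fun R s => exist _ (gzero E R (f R s), s) _) _)
    (@Mor (fprod (gpr E) f) (fprod (gpr E) f)
       (fun R x => exist _ (gopp E R (sval x).1, (sval x).2) _) _)
    _ _ _ _ _ _ _ _.
Next Obligation. by move=> E R [[x s] ex] [[y t] ey] /= e; rewrite ex ey e. Qed.
Next Obligation. by move=> E R [[x s] ex] [[y t] ey] e /=; rewrite gpr_add. Qed.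
Next Obligation. by move=> E R s /=; rewrite gpr_zero. Qed.
Next Obligation.
by move=> E R T g s; apply: sig_ext; rewrite /= !app_nat.
Qed.
Next Obligation. by move=> E R [[x s] ex] /=; rewrite gpr_opp. Qed.
Next Obligation.
by move=> E R T g x; apply: sig_ext; rewrite /= !app_nat.
Qed.
Next Obligation.
move=> E R T g x y e e'; apply: sig_ext; rewrite /=; congr pair.
exact: gadd_nat.
Qed.
Next Obligation. by []. Qed.
Next Obligation. by []. Qed.
Next Obligation. by []. Qed.
Next Obligation.
move=> E R x y z exy eyz e1 e2; apply: sig_ext; rewrite /=; congr pair.
exact: gaddA.
Qed.
Next Obligation.
move=> E R x y e e'; apply: sig_ext; rewrite /=; congr pair; last exact: e.
exact: gaddC.
Qed.
Next Obligation.
move=> E R [[x s] ex] e; apply: sig_ext; rewrite /=; congr pair.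
move: (pull_group_obligation_1 e) => {e} /=.
by move: ex => /= <- e'; apply: gadd0.
Qed.
Next Obligation.
move=> E R [[x s] ex] e; apply: sig_ext; rewrite /=; congr pair.
move: (pull_group_obligation_1 e) => {e} /=.
by move: ex => /= <- e'; apply: gaddN.
Qed.

Program Definition pull (A : comPzRingType) (M : amodule A S) : amodule A S' :=
  @AModule A S' (pull_group M)
    (fun a => @Mor (pull_group M) (pull_group M)
       (fun R x => exist _ (act M a R (sval x).1, (sval x).2) _) _) _ _ _ _.
Next Obligation.
by move=> A M a R [[x s] ex] /=; have [h _] := act_mor M a; rewrite [LHS]h.
Qed.
Next Obligation.
by move=> A M a R T g x; apply: sig_ext; rewrite /= !app_nat.
Qed.
Next Obligation.
move=> A M a; split=> // R x y e e'; apply: sig_ext; rewrite /=; congr pair.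
by have [_ h] := act_mor M a; apply: h.
Qed.
Next Obligation.
by move=> A M R [[x s] ex]; apply: sig_ext; rewrite /= act1.
Qed.
Next Obligation. by move=> *; apply: sig_ext; rewrite /= actM. Qed.
Next Obligation.
move=> A M a b R x e; apply: sig_ext; rewrite /=; congr pair; exact: actD.
Qed.

End Pullback.

(* The functor pi_*, where pis : A -> A' is pi^*. *)
Program Definition restrict (A A' : comPzRingType) (pis : {rmorphism A -> A'})
    (S : functor) (M : amodule A' S) : amodule A S :=
  @AModule A S M (fun a => act M (pis a)) _ _ _ _.
Next Obligation. by move=> *; apply: act_mor. Qed.
Next Obligation. by move=> *; rewrite /= rmorph1 act1. Qed.
Next Obligation. by move=> *; rewrite /= rmorphM actM. Qed.
Next Obligation.
by move=> A A' pis S M a b R x e; rewrite /= rmorphD; apply: actD.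
Qed.

Section Drinfeld.
Variables (k : finFieldType) (C : pointed_curve k).
Local Notation A := (cring C).

(* psi is the second component of a k-linear isomorphism of group schemes from
   M to the additive group over S; the first component is the projection. *)
Definition is_coordinate (S : functor) (c : mor S (Sp A)) (M : amodule A S)
    (psi : mor M A1) : Prop :=
  [/\ forall R (x y : M R) (e : gpr M R x = gpr M R y),
        psi R (gadd M e) = psi R x + psi R y,
      forall (l : k) R (x : M R),
        psi R (act M (kring C l) R x) = c R (gpr M R x) (kring C l) * psi R x
    & forall R (s : S R) (t : R),
        exists! x : M R, gpr M R x = s /\ psi R x = t].

(* psi o phi(a) o psi^-1 = \sum_(i < N) delta i tau^i is stated on points:
   tau is the map t |-> t^q. *)
Definition is_drinfeld (r : nat) (S : functor) (c : mor S (Sp A))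
    (M : amodule A S) : Prop :=
  [/\ is_scheme M,
      exists (I : Type) (U : I -> functor) (u : forall i, mor (U i) S),
        open_cover u /\
        forall i, exists psi : mor (pull (u i) M) A1,
          is_coordinate (comp c (u i)) psi
    & forall (B : comPzRingType) (u : mor (Sp B) S) (psi : mor (pull u M) A1),
        open_immersion u -> is_coordinate (comp c u) psi ->
        forall a : A, a != 0 ->
        exists (N : nat) (delta : nat -> B) (d : nat),
          [/\ forall i, (N <= i)%N -> delta i = 0,
              forall (R : comPzRingType) (x : pull u M R),
                psi R (act (pull u M) a R x) =
                \sum_(i < N) gpr (pull u M) R x (delta i)
                             * psi R x ^+ (#|k| ^ i),
              delta 0%N = c B (u B (rid B)) a,
              d%:Z = - (r%:Z * ord a * (deg C)%:Z)
            & (exists b, delta d * b = 1) /\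
              forall i, (d < i)%N -> exists m, delta i ^+ m = 0]].

End Drinfeld.

Section Restriction.
Variables (k : finFieldType) (C' C : pointed_curve k).
Variable pis : {rmorphism cring C -> cring C'}.
Variable r' : nat.
Local Notation A := (cring C).
Local Notation A' := (cring C').

Section Fiber.
Variables (S : functor) (c : mor S (Sp A)) (M : amodule A S).

(* Schemes over the fibre product of Sp A' and S over Sp A. *)
Record scheme_over := SchemeOver {
  tot :> functor;
  tot_scheme : is_scheme tot;
  to_A' : mor tot (Sp A');
  to_S : mor tot S;
  to_comm : mor_eq (comp (Sp_mor pis) to_A') (comp c to_S) }.

Definition is_over (T' T : scheme_over) (g : mor T' T) : Prop :=
  mor_eq (comp (to_A' T) g) (to_A' T') /\ mor_eq (comp (to_S T) g) (to_S T').

(* The isomorphism classes of these objects form the value at T of the fibre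
   product functor. *)
Record fiber_object (T : scheme_over) := FiberObject {
  fmod :> amodule A' T;
  fmod_drinfeld : is_drinfeld r' (to_A' T) fmod;
  fmod_iso : amodule_iso (pull (to_S T) M) (restrict pis fmod) }.

(* X represents the fibre product functor: theta induces bijections, natural
   in T, from isomorphism classes of objects over T to morphisms T -> X. *)
Definition fiber_representable : Prop :=
  exists (X : scheme_over)
    (theta : forall T : scheme_over, fiber_object T -> mor T X),
    [/\ forall T (x : fiber_object T), is_over (theta T x),
        forall T (x y : fiber_object T),
          mor_eq (theta T x) (theta T y) <-> amodule_iso x y,
        forall (T : scheme_over) (h : mor T X), is_over h ->
          exists x : fiber_object T, mor_eq (theta T x) h
      & forall (T T' : scheme_over) (g : mor T' T)
          (x : fiber_object T) (x' : fiber_object T'),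
          is_over g -> amodule_iso x' (pull g x) ->
          mor_eq (theta T' x') (comp (theta T x) g)].

End Fiber.

Definition relatively_representable (n : nat) : Prop :=
  forall (S : functor) (c : mor S (Sp A)) (M : amodule A S),
    is_scheme S -> is_drinfeld (n * r')%N c M -> fiber_representable c M.

End Restriction.

(* Main.v *)
(* Take k = F_3, C = C' = P^1 with infinity the point [0 : 1], and
   pi [x : y] = [x^2 : y^2], so that pi^* is T |-> T^2 on F_3[T].  Over F_3 with
   characteristic T |-> 0, let phi_T = tau^2 on the additive group.  Both
   phi'_T = tau and phi'_T = -tau satisfy phi'_{T^2} = phi_T.  An isomorphism
   between them over an extension K of F_3 is a scalar u with u^2 = -1: it exists
   over F_3(i) but not over F_3.  If the fibre functor were represented by X, the
   two structures would give distinct points of X(F_3) with the same image in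
   X(F_3(i)), whereas X(F_3) -> X(F_3(i)) is injective for every scheme X. *)

Require Import Defs.
From HB Require Import structures.
From mathcomp Require Import all_boot all_order all_algebra.
From mathcomp Require Import boolp.
From mathcomp Require classical_sets.
From mathcomp Require Import ring.

Set Implicit Arguments.
Unset Strict Implicit.
Unset Printing Implicit Defensive.
Import GRing.Theory Defs.
Local Open Scope ring_scope.
Local Obligation Tactic := idtac.

(** Injectivity of X(F_3) -> X(F_3(i)) rests on the fact that an open subfunctor cannot separate a
    field-valued point from its extension: the two points lie in a common affine chart, where they
    are ring homomorphisms to F_3. The choice of 3 is the smallest odd q: nonzero u in F_q satisfies
    u^(q-1) = 1, so no scalar of F_q conjugates tau into -tau. The characteristic T |-> 0 matches
    the vanishing constant coefficients of tau and tau^2, and F_3{tau} is commutative, so the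
    modules are described by composition of polynomials. Most of the work is to show that P^1, as a
    functor on all commutative rings, zero ring included, meets the definitions. Lines in R^2 are
    presented by 2 x 2 matrices of trace 1 and determinant 0, which turns statements on direct
    summands into polynomial identities; open conditions are tested at field-valued points. The
    definition of a Drinfeld module quantifies over all coordinates, so the automorphisms of the
    additive group over a field must be known; the same computation excludes an isomorphism over
    F_3. *)

Local Notation o := (@rev_ord 2).
Local Notation F3 := 'F_3.

(** * Commutative algebra *)

Definition is_ideal (R : comPzRingType) (I : R -> Prop) : Prop :=
  [/\ I 0, forall a b, I a -> I b -> I (a + b) & forall a b, I b -> I (a * b)].

(* (R/I)[1/s], in which a/s^n is represented by the pair (a, n).  It serves both
   for quotients (s = 1) and for localizations (I = 0). *)
Section QuotientLocalization.
Local Open Scope quotient_scope.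
Variables (R : comPzRingType) (I : R -> Prop) (s : R).
Hypothesis hI : is_ideal I.

Local Notation pair := (R * nat)%type.

Definition frac_eq (x y : pair) : bool :=
  `[< exists k, I (s ^+ k * (s ^+ y.2 * x.1 - s ^+ x.2 * y.1)) >].

Lemma frac_eqP x y :
  reflect (exists k, I (s ^+ k * (s ^+ y.2 * x.1 - s ^+ x.2 * y.1)))
    (frac_eq x y).
Proof. exact: asboolP. Qed.

Lemma frac_eq_refl : reflexive frac_eq.
Proof.
by move=> x; apply/frac_eqP; exists 0%N; rewrite subrr mulr0; case: hI.
Qed.

(** With both relations ending in [y], reflexivity yields symmetry, and then transitivity. *)
Lemma frac_eq_trans_sym x y z : frac_eq x y -> frac_eq z y -> frac_eq x z.
Proof.
case: x y z => a n [b m] [c p] /frac_eqP[k /= h] /frac_eqP[j /= h'].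
have [_ hD hM] := hI.
apply/frac_eqP; exists (k + j + m)%N => /=.
have -> : s ^+ (k + j + m) * (s ^+ p * a - s ^+ n * c) =
  s ^+ (j + p) * (s ^+ k * (s ^+ m * a - s ^+ n * b)) +
  - s ^+ (k + n) * (s ^+ j * (s ^+ m * c - s ^+ p * b)).
  by rewrite !exprD; ring.
by apply: hD; apply: hM.
Qed.

Lemma frac_eq_sym : symmetric frac_eq.
Proof.
by move=> x y; apply/idP/idP => h; apply: frac_eq_trans_sym (frac_eq_refl _) h.
Qed.

Lemma frac_eq_trans : transitive frac_eq.
Proof.
by move=> y x z h; rewrite frac_eq_sym => h'; apply: frac_eq_trans_sym h h'.
Qed.

Canonical frac_equiv :=
  EquivRel frac_eq frac_eq_refl frac_eq_sym frac_eq_trans.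

Definition frac_type := {eq_quot frac_eq}.
HB.instance Definition _ := Choice.on frac_type.
Local Notation cl := (\pi_{eq_quot frac_eq}).

Lemma clP (x y : pair) : cl x = cl y <-> frac_eq x y.
Proof. by split=> [/eqmodP|h]; last apply/eqmodP. Qed.

Definition frac_add (x y : pair) : pair :=
  (s ^+ y.2 * x.1 + s ^+ x.2 * y.1, (x.2 + y.2)%N).
Definition frac_opp (x : pair) : pair := (- x.1, x.2).
Definition frac_mul (x y : pair) : pair := (x.1 * y.1, (x.2 + y.2)%N).

Definition fadd (u v : frac_type) : frac_type := cl (frac_add (repr u) (repr v)).
Definition fopp (u : frac_type) : frac_type := cl (frac_opp (repr u)).
Definition fmul (u v : frac_type) : frac_type := cl (frac_mul (repr u) (repr v)).

Lemma repr_cl x : frac_eq (repr (cl x)) x.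
Proof. by apply/clP; rewrite reprK. Qed.

Lemma faddE x y : fadd (cl x) (cl y) = cl (frac_add x y).
Proof.
rewrite ?/fadd ?/fmul ?/fopp; apply/clP; have := repr_cl x; have := repr_cl y.
case: x y (repr (cl x)) (repr (cl y)) => a' n' [b' m'] [a n] [b m].
move=> /frac_eqP[k /= h] /frac_eqP[j /= h'].
have [_ hD hM] := hI.
apply/frac_eqP; exists (k + j)%N => /=.
have -> : s ^+ (k + j) * (s ^+ (n' + m') * (s ^+ m * a + s ^+ n * b) -
   s ^+ (n + m) * (s ^+ m' * a' + s ^+ n' * b')) =
   (s ^+ (j + n' + n)) * (s ^+ k * (s ^+ m' * b - s ^+ m * b')) +
   (s ^+ (k + m' + m)) * (s ^+ j * (s ^+ n' * a - s ^+ n * a')).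
  by rewrite !exprD; ring.
by apply: hD; apply: hM.
Qed.

Lemma fmulE x y : fmul (cl x) (cl y) = cl (frac_mul x y).
Proof.
rewrite ?/fadd ?/fmul ?/fopp; apply/clP; have := repr_cl x; have := repr_cl y.
case: x y (repr (cl x)) (repr (cl y)) => a' n' [b' m'] [a n] [b m].
move=> /frac_eqP[k /= h] /frac_eqP[j /= h'].
have [_ hD hM] := hI.
apply/frac_eqP; exists (k + j)%N => /=.
have -> : s ^+ (k + j) * (s ^+ (n' + m') * (a * b) -
   s ^+ (n + m) * (a' * b')) =
   (s ^+ (j + n') * a) * (s ^+ k * (s ^+ m' * b - s ^+ m * b')) +
   (s ^+ (k + m) * b') * (s ^+ j * (s ^+ n' * a - s ^+ n * a')).
  by rewrite !exprD; ring.
by apply: hD; apply: hM.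
Qed.

Lemma foppE x : fopp (cl x) = cl (frac_opp x).
Proof.
rewrite ?/fadd ?/fmul ?/fopp; apply/clP; have := repr_cl x; case: x (repr (cl x)) => b m [a n].
move=> /frac_eqP[k /= h]; have [_ _ hM] := hI.
apply/frac_eqP; exists k => /=.
have -> : s ^+ k * (s ^+ m * - a - s ^+ n * - b) =
  - 1 * (s ^+ k * (s ^+ m * a - s ^+ n * b)) by ring.
exact: hM.
Qed.

Lemma cl_eq x y : s ^+ y.2 * x.1 = s ^+ x.2 * y.1 -> cl x = cl y.
Proof.
move=> e; apply/clP/frac_eqP; exists 0%N; rewrite e subrr mulr0.
by case: hI.
Qed.

Lemma faddA : associative fadd.
Proof.
elim/quotW=> x; elim/quotW=> y; elim/quotW=> z.
rewrite (faddE y z) (faddE x y) (faddE x) (faddE _ z).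
by apply: cl_eq; rewrite /= !exprD; ring.
Qed.
Lemma faddC : commutative fadd.
Proof.
elim/quotW=> x; elim/quotW=> y; rewrite (faddE x) (faddE y).
by apply: cl_eq; rewrite /= !exprD; ring.
Qed.
Lemma fadd0 : left_id (cl (0, 0%N)) fadd.
Proof.
elim/quotW=> x; rewrite (faddE _ x).
by apply: cl_eq; rewrite /= !exprD expr0; ring.
Qed.
Lemma faddN : left_inverse (cl (0, 0%N)) fopp fadd.
Proof.
elim/quotW=> x; rewrite foppE (faddE _ x).
by apply: cl_eq; rewrite /= !exprD expr0; ring.
Qed.
HB.instance Definition _ := GRing.isZmodule.Build frac_type faddA faddC fadd0 faddN.

Lemma fmulA : associative fmul.
Proof.
elim/quotW=> x; elim/quotW=> y; elim/quotW=> z.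
rewrite (fmulE y z) (fmulE x y) (fmulE x) (fmulE _ z).
by apply: cl_eq; rewrite /= !exprD; ring.
Qed.
Lemma fmulC : commutative fmul.
Proof.
elim/quotW=> x; elim/quotW=> y; rewrite (fmulE x) (fmulE y).
by apply: cl_eq; rewrite /= !exprD; ring.
Qed.
Lemma fmul1 : left_id (cl (1, 0%N)) fmul.
Proof.
elim/quotW=> x; rewrite (fmulE _ x).
by apply: cl_eq; rewrite /= !exprD expr0; ring.
Qed.
Lemma fmulD : left_distributive fmul fadd.
Proof.
elim/quotW=> x; elim/quotW=> y; elim/quotW=> z.
rewrite (faddE x y) (fmulE _ z) (fmulE x z) (fmulE y z) (faddE (frac_mul _ _)).
by apply: cl_eq; rewrite /= !exprD; ring.
Qed.
HB.instance Definition _ :=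
  GRing.Zmodule_isComPzRing.Build frac_type fmulA fmulC fmul1 fmulD.

Definition to_frac (a : R) : frac_type := cl (a, 0%N).

Lemma to_frac_zmod : zmod_morphism to_frac.
Proof.
move=> a b; rewrite /to_frac [RHS](_ : _ = fadd (cl (a, 0%N)) (fopp (cl (b, 0%N)))) //.
by rewrite foppE faddE; apply: cl_eq; rewrite /= expr0; ring.
Qed.
Lemma to_frac_monoid : monoid_morphism to_frac.
Proof.
split=> // a b; rewrite [RHS](_ : _ = fmul (cl (a, 0%N)) (cl (b, 0%N))) //.
by rewrite fmulE.
Qed.
HB.instance Definition _ := GRing.isZmodMorphism.Build R frac_type to_frac to_frac_zmod.
HB.instance Definition _ := GRing.isMonoidMorphism.Build R frac_type to_frac to_frac_monoid.

Lemma quotient_localization :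
  exists (L : comPzRingType) (l : {rmorphism R -> L}),
    [/\ exists t, l s * t = 1, forall y : L, exists a k, l s ^+ k * y = l a
      & forall a, l a = 0 <-> exists k, I (s ^+ k * a)].
Proof.
exists frac_type, to_frac; split.
- exists (cl (1, 1%N)); rewrite [LHS](_ : _ = fmul (cl (s, 0%N)) (cl (1, 1%N))) //.
  by rewrite fmulE; apply: cl_eq; rewrite /= ?add0n ?expr1 expr0; ring.
- elim/quotW=> -[a n]; exists a, n; rewrite -rmorphXn.
  rewrite [LHS](_ : _ = fmul (cl (s ^+ n, 0%N)) (cl (a, n))) //.
  by rewrite fmulE; apply: cl_eq; rewrite /= !exprD expr0; ring.
move=> a; rewrite [0](_ : _ = cl (0, 0%N)) //; rewrite /to_frac; split.
  by move/clP/frac_eqP=> [k /=]; rewrite expr0 mulr0 subr0 mul1r; exists k.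
by case=> k h; apply/clP/frac_eqP; exists k; rewrite /= expr0 mulr0 subr0 mul1r.
Qed.

End QuotientLocalization.

Lemma ideal_quotient (R : comPzRingType) (I : R -> Prop) : is_ideal I ->
  exists (Q : comPzRingType) (p : {rmorphism R -> Q}),
    (forall y, exists a, p a = y) /\ forall a, p a = 0 <-> I a.
Proof.
move=> hI; have [Q [p [_ h1 h2]]] := quotient_localization 1 hI.
exists Q, p; split=> [y|a].
  by have [a [k e]] := h1 y; exists a; rewrite -e rmorph1 expr1n mul1r.
split=> [/h2[k]|h]; first by rewrite expr1n mul1r.
by apply/h2; exists 0%N; rewrite mul1r.
Qed.

Lemma localization (R : comPzRingType) (s : R) :
  exists (L : comPzRingType) (l : {rmorphism R -> L}), is_localization l s.
Proof.
have hI : is_ideal (fun a : R => a = 0).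
  by split=> // [a b -> ->|a b ->]; rewrite ?addr0 ?mulr0.
have [L [l [h1 h2 h3]]] := quotient_localization s hI.
by exists L, l; split=> // a /h3.
Qed.

(** [unit_ideal I] is [gen I 1] by conversion, so facts on generated ideals apply to it directly. *)
Definition gen (R : comPzRingType) (I : R -> Prop) (x : R) : Prop :=
  exists (n : nat) (a b : 'I_n -> R),
    (forall i, I (a i)) /\ \sum_(i < n) a i * b i = x.

Lemma gen_ideal (R : comPzRingType) (I : R -> Prop) : is_ideal (gen I).
Proof.
split.
- by exists 0%N, (fun=> 0), (fun=> 0); split=> [[]//|]; rewrite big_ord0.
- move=> _ _ [n [a [b [ha <-]]]] [m [a' [b' [ha' <-]]]].
  exists (n + m)%N, (fun i => match split i with inl j => a j | inr j => a' j end),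
    (fun i => match split i with inl j => b j | inr j => b' j end).
  split=> [i|]; first by case: (split i).
  rewrite big_split_ord /=; congr (_ + _); apply: eq_bigr => i _.
    by rewrite (unsplitK (inl i)).
  by rewrite (unsplitK (inr i)).
move=> c _ [n [a [b [ha <-]]]]; exists n, a, (fun i => c * b i); split=> //.
by rewrite mulr_sumr; apply: eq_bigr => i _; rewrite mulrCA.
Qed.

Lemma gen_in (R : comPzRingType) (I : R -> Prop) x : I x -> gen I x.
Proof.
by exists 1%N, (fun=> x), (fun=> 1); rewrite big_ord1 mulr1.
Qed.

Lemma ideal_sum (R : comPzRingType) (I : R -> Prop) (T : finType) (F : T -> R) :
  is_ideal I -> (forall i, I (F i)) -> I (\sum_i F i).
Proof. by case=> h0 hD _ hF; apply: (big_ind I). Qed.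

Lemma gen_sub (R : comPzRingType) (I J : R -> Prop) :
  is_ideal J -> (forall x, I x -> J x) -> forall x, gen I x -> J x.
Proof.
move=> hJ IJ _ [n [a [b [ha <-]]]]; apply: ideal_sum => // i.
by rewrite mulrC; case: hJ => _ _; apply; apply: IJ.
Qed.

Lemma unit_ideal_map (R S : comPzRingType) (f : {rmorphism R -> S})
    (I : R -> Prop) :
  unit_ideal I -> unit_ideal (fun s => exists2 a, I a & s = f a).
Proof.
case=> n [a [b [ha e]]]; exists n, (f \o a), (f \o b); split=> [i|].
  by exists (a i).
rewrite -(rmorph1 f) -e rmorph_sum; apply: eq_bigr => i _.
by rewrite rmorphM.
Qed.

Lemma inverses_field (Q : comPzRingType) :
  (1 : Q) <> 0 -> (forall x : Q, x <> 0 -> exists y, y * x = 1) ->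
  exists (K : fieldType) (f : {rmorphism Q -> K}), injective f.
Proof.
move=> h1 hV.
have hV' (x : Q) : exists y, (x != 0 -> y * x = 1) /\ (x = 0 -> y = 0).
  case: (eqVneq x 0) => [->|x0].
    by exists 0; split=> //; rewrite eqxx.
  by have [y e] := hV x (elimN eqP x0); exists y; split=> // x0'; rewrite x0' eqxx in x0.
have [inv] := choice hV' => /all_and2[invP] /(_ 0 erefl) inv0.
(* Destructing [Q] lets the field structure be packed on the same ring, so that the embedding is the
   identity. *)
case: Q h1 hV hV' inv invP inv0 => T cl h1 _ _ inv invP inv0.
have nz : (1 : GRing.ComPzRing.Pack cl) != 0 by apply/eqP.
pose nzm := GRing.PzSemiRing_isNonZero.Build (GRing.ComPzRing.Pack cl) nz.
pose N : comNzRingType := HB.pack (GRing.ComPzRing.Pack cl) nzm.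
pose fm := GRing.ComNzRing_isField.Build N invP inv0.
pose K : fieldType := HB.pack N fm.
by exists K, (rid (GRing.ComPzRing.Pack cl)) => x y.
Qed.

(** Zorn's lemma is applied to subsets that do not generate the unit ideal; the quotient by the
    ideal generated by a maximal one is a field. *)
Lemma field_point (R : comPzRingType) : (1 : R) <> 0 ->
  exists (K : fieldType) (f : {rmorphism R -> K}), True.
Proof.
move=> h1.
have [|A [nA maxA]] := @classical_sets.Zorn_bigcup R (fun A => ~ unit_ideal A).
  move=> F FP totF [n [a [b [ha e]]]].
  (* Finitely many elements of the union of a chain lie in one member; the empty list is separate
     because the chain may be empty. *)
  have: codom a = [::] \/ exists2 X, F X & forall x, x \in codom a -> X x.
    have: forall x, x \in codom a -> exists2 X, F X & X x.
      by move=> _ /codomP[i ->]; have [X FX Xa] := ha i; exists X.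
    elim: (codom a) => [|y s IH] hs; [by left|right].
    have [Y FY Yy] := hs y (mem_head _ _).
    case: IH => [x xs|s0|[X FX Xs]]; first by apply: hs; rewrite inE xs orbT.
      by exists Y => // x; rewrite s0 inE => /eqP->.
    case: (totF X Y FX FY) => XY.
      exists Y => // x; rewrite inE => /orP[/eqP->//|/Xs]; exact: XY.
    exists X => // x; rewrite inE => /orP[/eqP->|/Xs//]; exact: XY.
  case=> [a0|[X FX Xa]].
    apply: h1; rewrite -e big1 // => i.
    by have := codom_f a i; rewrite a0.
  apply: (FP X FX); exists n, a, b; split=> // i; exact/Xa/codom_f.
have [Q [p [ps pk]]] := ideal_quotient (gen_ideal A).
have [|y y0|K [f _]] := @inverses_field Q.
- by rewrite -(rmorph1 p) => /pk.
- have [x ex] := ps y; have nx : ~ gen A x by move/pk; rewrite ex.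
  have [n [a [b [ha e]]]] : unit_ideal (fun z => A z \/ z = x).
    apply: contrapT; apply: maxA; split=> [z Az|h]; first by left.
    by apply/nx/gen_in/h; right.
  suff [c hc] : exists c, gen A (1 - c * x).
    exists (p c); apply/eqP; rewrite eq_sym -subr_eq0; apply/eqP.
    by rewrite -ex -(rmorph1 p) -rmorphM -rmorphB; apply/pk.
  have [g0 gD gM] := gen_ideal A.
  rewrite -e; apply: (big_ind (fun z => exists c, gen A (z - c * x))).
  + by exists 0; rewrite mul0r subr0.
  + move=> z w [c hc] [d hd]; exists (c + d).
    by rewrite mulrDl opprD addrACA; apply: gD.
  move=> i _; case: (ha i) => [Aai|->].
    by exists 0; rewrite mul0r subr0 mulrC; apply/gM/gen_in.
  by exists (b i); rewrite mulrC subrr.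
by exists K, (rcomp f p).
Qed.

(** If [I] does not generate 1, the quotient by it is nonzero and has a field-valued point, where
    all of [I] vanishes. Openness can therefore be checked over fields. *)
Lemma unit_idealP (R : comPzRingType) (I : R -> Prop) :
  unit_ideal I <->
  forall (K : fieldType) (f : {rmorphism R -> K}), exists2 a, I a & f a != 0.
Proof.
split=> [[n [a [b [ha e]]]] K f|h].
  apply: contrapT => hn; have := oner_neq0 K.
  rewrite -(rmorph1 f) -e rmorph_sum big1 ?eqxx // => i _; rewrite rmorphM.
  case: (eqVneq (f (a i)) 0) => [->|n0]; first by rewrite mul0r.
  by case: hn; exists (a i).
apply: contrapT => hn.
have [Q [p [ps pk]]] := ideal_quotient (gen_ideal I).
have [|K [f _]] := @field_point Q.
  by rewrite -(rmorph1 p) => /pk.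
have [a Ia] := h K (rcomp f p); rewrite /rcomp /= (_ : p a = 0) ?rmorph0 ?eqxx //.
by apply/pk/gen_in.
Qed.

Lemma unit_ideal_fin (R : comPzRingType) (T : finType) (s : T -> R) :
  unit_ideal (fun a => exists i, a = s i) -> exists b, \sum_i s i * b i = 1.
Proof.
move=> h; have := @gen_sub R _ (fun x => exists b, \sum_i s i * b i = x) _ _ 1 h.
apply.
- split=> [|_ _ [b <-] [b' <-]|c _ [b <-]].
  + by exists (fun=> 0); rewrite big1 // => i _; rewrite mulr0.
  + exists (fun i => b i + b' i); rewrite -big_split.
    by apply: eq_bigr => i _; rewrite mulrDr.
  exists (fun i => c * b i); rewrite mulr_sumr.
  by apply: eq_bigr => i _; rewrite mulrCA.
move=> _ [i ->]; exists (fun j => (i == j)%:R).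
rewrite (bigD1 i) //= eqxx mulr1 big1 ?addr0 // => j.
by rewrite eq_sym => /negPf->; rewrite mulr0.
Qed.

(** Raising to a power does not change where an element vanishes at field-valued points. *)
Lemma partition_of_unity (R : comPzRingType) (T : finType) (s : T -> R) (N : nat) :
  unit_ideal (fun a => exists i, a = s i) -> exists b, \sum_i s i ^+ N * b i = 1.
Proof.
move=> /unit_idealP h; apply: unit_ideal_fin; apply/unit_idealP => K f.
have [_ [i ->] fi] := h K f; exists (s i ^+ N); first by exists i.
by rewrite rmorphXn expf_neq0.
Qed.

(** At every field-valued point [1 - d] is 1, so it generates the unit ideal, and it is killed by
    [d]. *)
Lemma idempotent_eq0 (R : comPzRingType) (d : R) : d * d = d ->
  (forall (K : fieldType) (f : {rmorphism R -> K}), f d = 0) -> d = 0.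
Proof.
move=> dd h.
have [n [a [b [ha e]]]] : unit_ideal (fun a => a = 1 - d).
  apply/unit_idealP => K f; exists (1 - d) => //.
  by rewrite rmorphB rmorph1 h subr0 oner_neq0.
rewrite -[d]mulr1 -e mulr_sumr big1 // => i _.
by rewrite ha mulrA mulrBr mulr1 dd subrr mul0r.
Qed.

(** * Universal property of the localization at one element *)

Section Localization.
Variables (R L : comPzRingType) (l : {rmorphism R -> L}) (s : R).
Hypothesis hl : is_localization l s.

Lemma loc_cancel (k : nat) (x y : L) : l s ^+ k * x = l s ^+ k * y -> x = y.
Proof.
have [[t e] _ _] := hl => h.
have tk : t ^+ k * l s ^+ k = 1 by rewrite -exprMn mulrC e expr1n.
by rewrite -[x]mul1r -[y]mul1r -tk -!mulrA h.
Qed.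

Lemma loc_eq (a b : R) : l a = l b -> exists k, s ^+ k * a = s ^+ k * b.
Proof.
have [_ _ h] := hl => e; have [|k hk] := h (a - b).
  by rewrite rmorphB e subrr.
by exists k; apply/eqP; rewrite -subr_eq0 -mulrBr hk.
Qed.

Lemma loc_lift (T : comPzRingType) (f : {rmorphism R -> T}) :
  (exists t, f s * t = 1) -> exists g : {rmorphism L -> T}, rcomp g l = f.
Proof.
case=> t e; have [[t' e'] h2 h3] := hl.
have fk k x y : f s ^+ k * x = f s ^+ k * y -> x = y.
  have tk : t ^+ k * f s ^+ k = 1 by rewrite -exprMn mulrC e expr1n.
  by move=> h; rewrite -[x]mul1r -[y]mul1r -tk -!mulrA h.
(* The value at [y] is required to fit every fraction that represents [y], so any representation may
   be used to check additivity and multiplicativity. *)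
have hg y : exists z, forall k a, l s ^+ k * y = l a -> f s ^+ k * z = f a.
  have [a [k ea]] := h2 y; exists (t ^+ k * f a) => j b eb.
  have [m em] : exists m, s ^+ m * (s ^+ j * a) = s ^+ m * (s ^+ k * b).
    apply: loc_eq; rewrite !rmorphM !rmorphXn -ea -eb; ring.
  apply: (fk m); apply: (fk k).
  transitivity (f s ^+ k * t ^+ k * (f s ^+ m * (f s ^+ j * f a))); first ring.
  rewrite -exprMn e expr1n mul1r -!rmorphXn -!rmorphM em.
  congr (f _); ring.
pose g y := sval (cid (hg y)).
have gP y k a : l s ^+ k * y = l a -> f s ^+ k * g y = f a.
  by rewrite /g; case: cid => z /= h /h.
have gB : zmod_morphism g.
  move=> x y; have [a [k ea]] := h2 x; have [b [j eb]] := h2 y.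
  apply: (fk (k + j)%N); rewrite (gP _ _ (s ^+ j * a - s ^+ k * b)).
    rewrite rmorphB !rmorphM !rmorphXn -(gP _ _ _ ea) -(gP _ _ _ eb) exprD; ring.
  rewrite rmorphB !rmorphM !rmorphXn -ea -eb exprD; ring.
have gM : monoid_morphism g.
  split; first by have := gP 1 0%N 1; rewrite !mul1r !rmorph1; apply.
  move=> x y; have [a [k ea]] := h2 x; have [b [j eb]] := h2 y.
  apply: (fk (k + j)%N); rewrite (gP _ _ (a * b)).
    rewrite rmorphM -(gP _ _ _ ea) -(gP _ _ _ eb) exprD; ring.
  rewrite rmorphM -ea -eb exprD; ring.
pose gz := GRing.isZmodMorphism.Build L T g gB.
pose gm := GRing.isMonoidMorphism.Build L T g gM.
pose G : {rmorphism L -> T} := HB.pack g gz gm.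
exists G; apply: rmorph_ext => a.
by have := gP (l a) 0%N a; rewrite !mul1r; apply.
Qed.

End Localization.

(** * Sheaves and open subfunctors *)

Lemma uniform_bound (T : finType) (P : T -> nat -> Prop) :
  (forall i k k', (k <= k')%N -> P i k -> P i k') ->
  (forall i, exists k, P i k) -> exists N, forall i, P i N.
Proof.
move=> mono /choice[k hk]; exists (\max_i k i)%N => i.
exact: mono (leq_bigmax i) (hk i).
Qed.

Section Cover.
Variables (R : comPzRingType) (n : nat) (s : 'I_n -> R).
Variables (L : 'I_n -> comPzRingType) (l : forall i, {rmorphism R -> L i}).
Hypothesis hs : unit_ideal (fun a => exists i, a = s i).
Hypothesis hl : forall i, is_localization (l i) (s i).

Lemma zariski_sep (x y : R) : (forall i, l i x = l i y) -> x = y.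
Proof.
move=> e; have [i k k' kk|N hN] :=
  @uniform_bound _ (fun i k => s i ^+ k * x = s i ^+ k * y) _
    (fun i => loc_eq (hl i) (e i)).
  by rewrite -(subnK kk) exprD -!mulrA => ->.
have [b eb] := partition_of_unity N hs.
rewrite -[x]mul1r -[y]mul1r -eb !mulr_suml; apply: eq_bigr => i _.
by rewrite mulrAC hN mulrAC.
Qed.

(** Gluing data are compatible over all test rings [T]; the localization at [s i * s j] is the one
    that turns this into equations in [R]. *)
Lemma overlap i j : exists (T : comPzRingType) (g : {rmorphism L i -> T})
    (h : {rmorphism L j -> T}),
  rcomp g (l i) = rcomp h (l j) /\ is_localization (rcomp g (l i)) (s i * s j).
Proof.
have [T [m hm]] := localization (s i * s j).
have [[t e] _ _] := hm; rewrite rmorphM in e.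
have [|g eg] := loc_lift (hl i) (f := m).
  by exists (m (s j) * t); rewrite mulrA.
have [|h eh] := loc_lift (hl j) (f := m).
  by exists (m (s i) * t); rewrite mulrCA mulrA.
by exists T, g, h; rewrite eg eh.
Qed.

Lemma zariski_glue (x : forall i, L i) :
  (forall i j (T : comPzRingType) (g : {rmorphism L i -> T})
     (h : {rmorphism L j -> T}), rcomp g (l i) = rcomp h (l j) ->
     g (x i) = h (x j)) ->
  exists y, forall i, l i y = x i.
Proof.
move=> hx.
(* One exponent [N] serves all indices: [x i] is the fraction of [a i] by [s i ^+ N]. *)
have [i k k' kk [a ea]|N /choice[a ha]] :=
  @uniform_bound _ (fun i k => exists a, l i (s i) ^+ k * x i = l i a) _
    (fun i => let: And3 _ h _ := hl i in
              let: ex_intro a (ex_intro k e) := h (x i) in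
              ex_intro _ k (ex_intro _ a e)).
  by exists (s i ^+ (k' - k) * a); rewrite rmorphM rmorphXn -ea mulrA -exprD subnK.
(* On overlaps the fractions agree, so the cross products agree in [R] after multiplication by a
   common power [M] of [s i * s j]. *)
have [p k k' kk|[i j] /=|M hM] := @uniform_bound _ (fun (p : 'I_n * 'I_n) k =>
    (s p.1 * s p.2) ^+ k * (s p.2 ^+ N * a p.1) =
    (s p.1 * s p.2) ^+ k * (s p.1 ^+ N * a p.2)) _ _.
- by rewrite -(subnK kk) exprD -!mulrA => ->.
- have [T [g [h [e hm]]]] := overlap i j.
  apply: (loc_eq hm).
  have eg u : g (l i u) = h (l j u) by exact: (congr1 (fun f : {rmorphism _ -> _} => f u) e).
  rewrite /rcomp /= !rmorphM !rmorphXn /= -ha (eg (a j)) -(ha j) !rmorphM !rmorphXn /=.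
  by rewrite !eg (hx _ _ _ _ _ e) mulrCA.
(* Expanding the fractions by [s i ^+ M] makes the cross products agree exactly; a partition of
   unity in the new denominators [s i ^+ (N + M)] then glues the numerators. *)
have {}hM i j : s j ^+ (N + M) * (s i ^+ M * a i) = s i ^+ (N + M) * (s j ^+ M * a j).
  have := hM (i, j); rewrite /= !exprMn !exprD => h.
  by transitivity (s i ^+ M * s j ^+ M * (s j ^+ N * a i)); [ring|rewrite h; ring].
have [b eb] := partition_of_unity (N + M) hs.
exists (\sum_j b j * (s j ^+ M * a j)) => i.
apply: (loc_cancel (hl i) (k := N + M)).
rewrite -rmorphXn -rmorphM mulr_sumr.
transitivity (l i (s i ^+ M * a i)).
  congr (l i _); rewrite -[RHS]mul1r -eb mulr_suml; apply: eq_bigr => j _.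
  by rewrite mulrCA -hM mulrCA mulrA.
by rewrite rmorphM !rmorphXn -ha exprD mulrA [_ ^+ M * _]mulrC.
Qed.

End Cover.

Lemma A1_sheaf : zariski_sheaf A1.
Proof.
move=> R n s L l hs hl x hx; have [y hy] := zariski_glue hs hl hx.
exists y; split=> // z hz; apply: (zariski_sep hs hl) => i.
by rewrite hy; apply/esym/hz.
Qed.

Lemma Sp_sheaf (B : comPzRingType) : zariski_sheaf (Sp B).
Proof.
move=> R n s L l hs hl x hx.
have /choice[y hy] : forall b, exists y, forall i, l i y = x i b.
  move=> b; apply: (zariski_glue hs hl) => i j T g h e.
  by have := hx i j T g h e => /(congr1 (fun f : {rmorphism _ -> _} => f b)).
have sep := zariski_sep hs hl.
have yB : zmod_morphism y by move=> a b; apply: sep => i; rewrite rmorphB !hy rmorphB.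
have yM : monoid_morphism y.
  by split=> [|a b]; apply: sep => i; rewrite ?rmorphM ?rmorph1 !hy ?rmorphM ?rmorph1.
pose yz := GRing.isZmodMorphism.Build B R y yB.
pose ym := GRing.isMonoidMorphism.Build B R y yM.
exists (HB.pack_for {rmorphism B -> R} y yz ym); split=> [i|z hz].
  by apply: rmorph_ext => b; apply: hy.
apply: rmorph_ext => b; apply: sep => i.
by rewrite [LHS]hy -hz.
Qed.

Lemma prod_sheaf (X Y : functor) :
  zariski_sheaf X -> zariski_sheaf Y -> zariski_sheaf (prod_fun X Y).
Proof.
move=> hX hY R n s L l hs hl z hz.
have [|x [hx ux]] := hX R n s L l hs hl (fun i => (z i).1).
  by move=> i j T g h /(hz i j T g h) /(congr1 fst).
have [|y [hy uy]] := hY R n s L l hs hl (fun i => (z i).2).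
  by move=> i j T g h /(hz i j T g h) /(congr1 snd).
exists (x, y); split=> [i|[x' y'] h] /=; first by rewrite hx hy -surjective_pairing.
by congr pair; [apply: ux|apply: uy] => i; rewrite -h.
Qed.

Lemma iso_open_immersion (X Y : functor) (f : mor X Y) :
  is_iso f -> open_immersion f.
Proof.
move=> hf; split=> [R|]; first exact: bij_inj.
have im R (y : Y R) : image f y.
  by have [g _ fK] := hf R; exists (g y).
split=> // R x; exists (fun a => a = 1) => S g; split=> // _.
apply: unit_ideal_map; exists 1%N, (fun=> 1), (fun=> 1).
by rewrite big_ord1 mulr1.
Qed.

Lemma affine_scheme (X : functor) (B : comPzRingType) (u : mor (Sp B) X) :
  zariski_sheaf X -> is_iso u -> is_scheme X.
Proof.
move=> hX hu; split=> //; exists unit, (fun=> B), (fun=> u); split=> [_|K x].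
  exact: iso_open_immersion.
by exists tt; have [g _ uK] := hu K; exists (g x).
Qed.

Definition id_mor (X : functor) : mor X X :=
  @Mor X X (fun R x => x) (fun _ _ _ _ => erefl).

Lemma id_iso (X : functor) : is_iso (id_mor X).
Proof. by move=> R; exists id. Qed.

Lemma Sp_scheme (B : comPzRingType) : is_scheme (Sp B).
Proof. exact: affine_scheme (@Sp_sheaf B) (@id_iso _). Qed.

Lemma open_preimage (X Y : functor) (m : mor X Y) (U : subset_of Y) :
  is_open U -> is_open (fun R x => U R (m R x)).
Proof.
case=> hst hU; split=> [R S f x|R x]; first by rewrite app_nat; apply: hst.
by have [I hI] := hU R (m R x); exists I => S f; rewrite app_nat.
Qed.

(** The inverse image of [U] in [Sp K] is some D(I). A point over a nonzero ring forces [I] to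
    contain a nonzero element of [K], and then D(I) is all of [Sp K]. *)
Lemma open_descent (X : functor) (U : subset_of X) (K : fieldType)
    (R : comPzRingType) (f : {rmorphism K -> R}) (x : X K) :
  is_open U -> (1 : R) <> 0 -> U R (fmap X f x) -> U K x.
Proof.
case=> _ hU R1 /=; have [I hI] := hU K x => /hI /unit_idealP h.
have [F [g _]] := field_point R1; have [_ [a Ia ->] ga] := h F g.
rewrite -(fmap_id x); apply/hI/unit_idealP => K' h'; exists a; first by exists a.
rewrite fmorph_eq0; apply: contraNneq ga => ->.
by rewrite !rmorph0.
Qed.

(** By [open_descent] a chart through [x] also contains [y]. In that chart both are homomorphisms to
    [K], and [f] is injective on [K]. The functor of isomorphism classes violates exactly this
    property. *)
Lemma scheme_points_inj (X : functor) (K : fieldType) (R : comPzRingType)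
    (f : {rmorphism K -> R}) :
  is_scheme X -> (1 : R) <> 0 -> injective (@fmap X _ _ f).
Proof.
case=> _ [I [B [u [hu cov]]]] R1 x y e.
have [i [b eb]] := cov K x; have [inj op] := hu i.
have [b' eb'] : image (u i) y.
  apply: (open_descent (f := f)) => //; exists (fmap _ f b).
  by rewrite app_nat eb e.
rewrite -eb -eb'; congr (u i K _).
have {}e : rcomp f b = rcomp f b'.
  by apply: inj; rewrite [LHS](app_nat (u i) f b) [RHS](app_nat (u i) f b') eb eb'.
have finj c d : f c = f d -> c = d.
  move=> ecd; apply/eqP; rewrite -subr_eq0; apply/eqP.
  apply: contrapT => /eqP n0; apply: R1.
  rewrite -(rmorph1 f) -(mulVf n0) rmorphM [f (c - d)]rmorphB ecd subrr.
  by rewrite mulr0.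
apply: rmorph_ext => a; apply: finj.
exact: (congr1 (fun g : {rmorphism _ -> _} => g a) e).
Qed.

(** * Projective space as a Zariski sheaf *)

Section Lines.
Variable N : nat.

Lemma line_ext (R : comPzRingType) (x y : PN N R) :
  (forall v, sval x v <-> sval y v) -> x = y.
Proof. by move=> h; apply: sig_ext; apply/funext => v; apply/propext. Qed.

Lemma lineP (R : comPzRingType) (x : PN N R) :
  exists e : 'M[R]_N.+1,
    [/\ e *m e = e, forall v, sval x v <-> v *m e = v
      & forall (K : fieldType) (f : {rmorphism R -> K}),
          \rank (map_mx f e) = 1%N].
Proof. by case: x. Qed.

Lemma fmap_line (R S : comPzRingType) (f : {rmorphism R -> S}) (x : PN N R) e :
  e *m e = e -> (forall v, sval x v <-> v *m e = v) ->
  forall w, sval (fmap (PN N) f x) w <-> w *m map_mx f e = w.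
Proof. exact: span_imageE. Qed.

(** For idempotents, [e *m e' = e] expresses that the row space of [e] lies in that of [e']. *)
Lemma mul_idempotent (R : comPzRingType) (e e' : 'M[R]_N.+1) :
  e *m e = e -> (forall v : 'rV_N.+1, v *m e = v -> v *m e' = v) -> e *m e' = e.
Proof.
by move=> ee h; apply/row_matrixP => i; rewrite row_mul h // -row_mul ee.
Qed.

Lemma map_mx_comp_eq (R S S' T : comPzRingType) (l : {rmorphism R -> S})
    (l' : {rmorphism R -> S'}) (g : {rmorphism S -> T}) (h : {rmorphism S' -> T})
    (A : 'M[R]_N.+1) :
  rcomp g l = rcomp h l' -> map_mx g (map_mx l A) = map_mx h (map_mx l' A).
Proof.
move=> e; apply/matrixP => i j; rewrite !mxE.
exact: (congr1 (fun f : {rmorphism _ -> _} => f (A i j)) e).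
Qed.

Lemma loc_cancel_mx (R L : comPzRingType) (l : {rmorphism R -> L}) (s : R)
    (k : nat) (A B : 'M[L]_N.+1) :
  is_localization l s -> l s ^+ k *: A = l s ^+ k *: B -> A = B.
Proof.
move=> hl /matrixP e; apply/matrixP => i j; have := e i j; rewrite !mxE.
by move=> h; apply: (loc_cancel hl h).
Qed.

(** The idempotents [e i] presenting the local lines need not agree on overlaps; only their row
    spaces do, that is, [e i *m e j = e i]. They cannot be glued entrywise, but a combination of
    them whose weights sum to 1 is again an idempotent with the same row space, and a partition of
    unity provides the weights. *)
Lemma PN_sheaf : zariski_sheaf (PN N).
Proof.
move=> R n s L l hs hl x hx; have sep := zariski_sep hs hl.
pose e i := sval (cid (lineP (x i))); have he i := svalP (cid (lineP (x i))).
have ee i : e i *m e i = e i by case: (he i).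
have mem i v : sval (x i) v <-> v *m e i = v by case: (he i).
have compat i j (T : comPzRingType) (g : {rmorphism L i -> T}) (h : {rmorphism L j -> T}) :
    rcomp g (l i) = rcomp h (l j) ->
    map_mx g (e i) *m map_mx h (e j) = map_mx g (e i).
  move=> egh; apply: mul_idempotent => [|v hv]; first by rewrite -map_mxM ee.
  apply/(fmap_line h (ee j) (mem j)).
  by rewrite -(hx _ _ _ _ _ egh); apply/(fmap_line g (ee i) (mem i)).
(* A common power [m] clears the denominators of all entries of the [e i], giving the matrices [E i]
   over [R]. *)
have [p k k' kk [a ea]|[[i a] b]|m hm] :=
    @uniform_bound _ (fun (p : 'I_n * 'I_N.+1 * 'I_N.+1) k => exists a,
      l p.1.1 (s p.1.1) ^+ k * e p.1.1 p.1.2 p.2 = l p.1.1 a) _ _.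
- exists (s p.1.1 ^+ (k' - k) * a).
  by rewrite rmorphM rmorphXn -ea mulrA -exprD subnK.
- by have [_ h _] := hl i; have [c [k ec]] := h (e i a b); exists k, c.
have /choice[E hE] : forall i, exists E, map_mx (l i) E = l i (s i) ^+ m *: e i.
  move=> i; have /choice[F hF] := fun p => hm (i, p.1, p.2).
  exists (\matrix_(a, b) F (a, b)); apply/matrixP => a b; rewrite !mxE.
  by have := hF (a, b) => /= ->.
(* After multiplication by a power [M] of [s i * s j], the relation between row spaces holds over
   [R]. *)
have [p k k' kk|[[[i j] a] b]|M hM] :=
    @uniform_bound _ (fun (p : 'I_n * 'I_n * 'I_N.+1 * 'I_N.+1) k =>
      let: (i, j, a, b) := p in (s i * s j) ^+ k * (E i *m E j) a b =
                                (s i * s j) ^+ k * (s j ^+ m *: E i) a b) _ _.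
- by case: p => [[[i j] a] b]; rewrite -(subnK kk) exprD -!mulrA => ->.
- have [T [g [h [egh hloc]]]] := overlap hl i j.
  apply: (loc_eq hloc).
  suff /matrixP/(_ a b) : map_mx (rcomp g (l i)) (E i *m E j) =
      map_mx (rcomp g (l i)) (s j ^+ m *: E i) by rewrite !mxE.
  have sc c (A : 'M_N.+1) : map_mx g (c *: A) = g c *: map_mx g A.
    by apply/matrixP => u v; rewrite !mxE rmorphM.
  have sc' c (A : 'M_N.+1) : map_mx h (c *: A) = h c *: map_mx h A.
    by apply/matrixP => u v; rewrite !mxE rmorphM.
  have eg u : g (l i u) = h (l j u) by exact: (congr1 (fun f : {rmorphism _ -> _} => f u) egh).
  have mr (A : 'M_N.+1) : map_mx (rcomp g (l i)) A = map_mx g (map_mx (l i) A).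
    by apply/matrixP => u v; rewrite !mxE.
  rewrite map_mxM map_mxZ (mr (E i)) (mr (E j)) (map_mx_comp_eq (E j) egh).
  rewrite (hE i) (hE j) sc sc'.
  rewrite -scalemxAl -scalemxAr (compat _ _ _ _ _ egh) !scalerA.
  congr (_ *: _); rewrite !rmorphXn -eg mulrC.
  by [].
have {}hM i j : s j ^+ M *: (s i ^+ M *: (E i *m E j)) =
    s j ^+ (M + m) *: (s i ^+ M *: E i).
  apply/matrixP => a b; have := hM (i, j, a, b).
  rewrite !mxE exprMn exprD => h.
  transitivity (s i ^+ M * s j ^+ M * \sum_j0 E i a j0 * E j j0 b).
    by rewrite mulrCA mulrA.
  by rewrite h; ring.
have [b eb] := partition_of_unity (M + m) hs.
(* Where all [s i] are invertible this is the combination of the [e i] with weights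
   [b i * s i ^+ (M + m)], whose sum is 1. *)
pose e' := \sum_i b i *: (s i ^+ M *: E i).
have Ee' i : (s i ^+ M *: E i) *m e' = s i ^+ M *: E i.
  rewrite mulmx_sumr -[RHS]scale1r -eb scaler_suml; apply: eq_bigr => j _.
  by rewrite -!scalemxAr -scalemxAl hM [in RHS]mulrC -[RHS]scalerA.
have ee' : e' *m e' = e'.
  rewrite {1 3}/e' mulmx_suml; apply: eq_bigr => i _.
  by rewrite -scalemxAl Ee'.
have e1 i : e i *m map_mx (l i) e' = e i.
  apply: (loc_cancel_mx (k := (M + m)%N) (hl i)).
  rewrite scalemxAl exprD -scalerA -hE.
  by rewrite -!rmorphXn -map_mxZ -map_mxM Ee'.
have e2 i : map_mx (l i) e' *m e i = map_mx (l i) e'.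
  rewrite /e' raddf_sum mulmx_suml /=; apply: eq_bigr => j _.
  rewrite /= map_mxZ -scalemxAl; congr (_ *: _).
  apply: (loc_cancel_mx (k := (M + m)%N) (hl i)).
  rewrite -[in RHS]rmorphXn -[RHS]map_mxZ -hM [in LHS]exprD -scalerA scalemxAr -hE.
  by rewrite -map_mxM -rmorphXn -map_mxZ -scalemxAl.
have mem' i v : sval (x i) v <-> v *m map_mx (l i) e' = v.
  split=> [/mem <-|<-]; first by rewrite -mulmxA e1.
  by apply/mem; rewrite -mulmxA e2.
have le' : line (fun v => v *m e' = v).
  exists e'; split=> // K f.
  have /unit_idealP/(_ K f)[_ [i ->] fi] := hs.
  have [|g eg] := loc_lift (hl i) (f := f).
    by exists (f (s i))^-1; rewrite mulfV.
  have [_ _ /(_ K g)] := he i; rewrite -/(e i) => <-.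
  rewrite -eg map_mx_comp; apply/eqP; rewrite eqn_leq; apply/andP; split.
    by rewrite -e2 map_mxM; apply/mxrankS/submxMl.
  by rewrite -{1}(e1 i) map_mxM; apply/mxrankS/submxMl.
exists (exist _ _ le'); split=> [i|z hz].
  apply: line_ext => v; apply: iff_trans (iff_sym (mem' i v)).
  exact: fmap_line.
(* For uniqueness, [e' *m f = e'] and [f *m e' = f] are checked locally; they make the row spaces
   equal. *)
have [f [ff memf _]] := lineP z.
have memi i (v : 'rV[L i]_N.+1) : v *m map_mx (l i) f = v <-> v *m map_mx (l i) e' = v.
  by apply: (iff_trans (iff_sym (fmap_line (l i) ff memf v))); rewrite hz; apply: mem'.
have mx_sep (A B : 'M[R]_N.+1) : (forall i, map_mx (l i) A = map_mx (l i) B) -> A = B.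
  move=> h; apply/matrixP => a c; apply: sep => i.
  by have /matrixP/(_ a c) := h i; rewrite !mxE.
apply: line_ext => v /=; split=> [ve|/memf vf].
  apply/memf; rewrite -ve -mulmxA; congr (_ *m _); apply: mx_sep => i.
  rewrite map_mxM; apply: mul_idempotent; first by rewrite -map_mxM ee'.
  by move=> w /memi.
rewrite -vf -mulmxA; congr (_ *m _); apply: mx_sep => i.
rewrite map_mxM; apply: mul_idempotent; first by rewrite -map_mxM ff.
by move=> w /memi.
Qed.

End Lines.

(** * Lines in R^2 *)

(* A substitute for [horner] and [map_poly], which require nonzero rings. *)
Section WeightedSum.
Variables (k : comNzRingType) (R : comPzRingType) (rho : {rmorphism k -> R}).
Implicit Type w : nat -> R.

(** Three families of weights occur: [t ^+ i] for evaluation, [x ^+ (size h - i) * y ^+ i] for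
    homogenization and [t ^+ (3 ^ i)] for the action of tau. *)
Definition wsum w (p : {poly k}) : R := \sum_(i < size p) rho p`_i * w i.

Lemma wsumE w (p : {poly k}) n :
  (size p <= n)%N -> wsum w p = \sum_(i < n) rho p`_i * w i.
Proof.
move=> h; rewrite /wsum (big_ord_widen n (fun i => rho p`_i * w i)) // big_mkcond.
apply: eq_bigr => i _; case: ltnP => // hi.
by rewrite nth_default // rmorph0 mul0r.
Qed.

Lemma wsum_zmod w : zmod_morphism (wsum w).
Proof.
move=> p q; pose n := maxn (size p) (size q).
rewrite (@wsumE w p n) ?leq_maxl // (@wsumE w q n) ?leq_maxr //.
rewrite (@wsumE w _ n); last by rewrite (leq_trans (size_polyD _ _)) // size_polyN.
rewrite -sumrB; apply: eq_bigr => i _.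
by rewrite coefB rmorphB mulrBl.
Qed.
HB.instance Definition _ w := GRing.isZmodMorphism.Build {poly k} R (wsum w) (wsum_zmod w).

Lemma wsumC w c : wsum w c%:P = rho c * w 0%N.
Proof. by rewrite (@wsumE w _ 1) ?size_polyC_leq1 // big_ord1 coefC. Qed.

Lemma wsumMX w p : wsum w (p * 'X) = wsum (fun i => w i.+1) p.
Proof.
rewrite (@wsumE w (p * 'X) (size p).+1).
  rewrite big_ord_recl coefMX /=.
  rewrite rmorph0 mul0r add0r; apply: eq_bigr => i _.
  by rewrite coefMX.
by rewrite (leq_trans (size_polyMleq _ _)) // size_polyX addn2.
Qed.

Lemma wsumCM w c p : wsum w (c%:P * p) = rho c * wsum w p.
Proof.
rewrite (@wsumE w _ (size p)); last by rewrite mul_polyC size_scale_leq.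
by rewrite mulr_sumr; apply: eq_bigr => i _; rewrite coefCM rmorphM mulrA.
Qed.

End WeightedSum.

Section Evaluation.
Variables (k : comNzRingType) (R : comPzRingType) (rho : {rmorphism k -> R}).
Variable t : R.

Definition peval : {poly k} -> R := wsum rho (fun i => t ^+ i).
HB.instance Definition _ := GRing.Additive.on peval.

Lemma pevalMX p : peval (p * 'X) = peval p * t.
Proof.
rewrite [LHS]wsumMX /peval /wsum mulr_suml; apply: eq_bigr => i _.
by rewrite exprS; ring.
Qed.

Lemma peval_monoid : monoid_morphism peval.
Proof.
split=> [|p q]; first by rewrite [LHS]wsumC rmorph1 mulr1.
elim/poly_ind: p => [|p c IH]; first by rewrite mul0r raddf0 mul0r.
rewrite mulrDl mulrAC !raddfD /= !pevalMX IH [peval (c%:P * q)]wsumCM.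
by rewrite [peval c%:P]wsumC expr0 -/(peval q); ring.
Qed.
HB.instance Definition _ := GRing.isMonoidMorphism.Build {poly k} R peval peval_monoid.

Definition ev : {rmorphism {poly k} -> R} := peval.

Lemma evC c : ev c%:P = rho c.
Proof. by rewrite [LHS]wsumC mulr1. Qed.

Lemma evX : ev 'X = t.
Proof. by rewrite -['X]mul1r [LHS]pevalMX rmorph1 mul1r. Qed.

End Evaluation.

Lemma poly_rmorph_ext (k : comNzRingType) (R : comPzRingType)
    (f g : {rmorphism {poly k} -> R}) :
  f 'X = g 'X -> (forall c, f c%:P = g c%:P) -> f = g.
Proof.
move=> eX eC; apply: rmorph_ext; elim/poly_ind => [|p c IH].
  by rewrite !rmorph0.
by rewrite !rmorphD !rmorphM IH eX eC.
Qed.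

(** * Rank 1 idempotents and the two affine charts *)

Lemma sum2 (V : nmodType) (F : 'I_2 -> V) i :
  \sum_j F j = F i + F (rev_ord i).
Proof.
rewrite big_ord_recl big_ord1; case: i => [[|[|//]] hi] /=.
  by congr (F _ + F _); apply: val_inj.
by rewrite addrC; congr (F _ + F _); apply: val_inj.
Qed.

Lemma rev_ord_neq (i : 'I_2) : (rev_ord i == i) = false.
Proof. by case: i => [[|[|//]] hi]. Qed.

Lemma ord2P (i j : 'I_2) : j = i \/ j = rev_ord i.
Proof.
case: i j => [[|[|//]] hi] [[|[|//]] hj]; [left|right|right|left]; exact: val_inj.
Qed.

(** Trace 1 and determinant 0: the equational form of an idempotent of rank 1. The quantifier over
    [i] lets both charts be treated by the same lemmas. *)
Definition rank1_mx (R : comPzRingType) (e : 'M[R]_2) : Prop :=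
  forall i, e i i + e (o i) (o i) = 1 /\ e i i * e (o i) (o i) = e i (o i) * e (o i) i.

Lemma rank1_mxW (R : comPzRingType) (e : 'M[R]_2) (i : 'I_2) :
  e i i + e (o i) (o i) = 1 -> e i i * e (o i) (o i) = e i (o i) * e (o i) i ->
  rank1_mx e.
Proof.
move=> t d i'; case: (ord2P i i') => ->; first by split.
by rewrite rev_ordK addrC mulrC [e (o i) i * _]mulrC.
Qed.

Lemma rank1_mx_map (R S : comPzRingType) (f : {rmorphism R -> S}) (e : 'M[R]_2) :
  rank1_mx e -> rank1_mx (map_mx f e).
Proof.
by move=> h i; have [t d] := h i; rewrite !mxE -rmorphD t rmorph1 -!rmorphM d.
Qed.

Lemma rank1_mx_idem (R : comPzRingType) (e : 'M[R]_2) : rank1_mx e -> e *m e = e.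
Proof.
move=> h; apply/matrixP => i l; rewrite mxE (sum2 _ i).
have [t d] := h i; case: (ord2P i l) => ->.
  by rewrite -d -mulrDr t mulr1.
by rewrite [e i i * _]mulrC -mulrDr t mulr1.
Qed.

Lemma det2 (R : comPzRingType) (e : 'M[R]_2) (i : 'I_2) :
  \det e = e i i * e (o i) (o i) - e i (o i) * e (o i) i.
Proof.
have -> : \det e = e 0 0 * e (o 0) (o 0) - e 0 (o 0) * e (o 0) 0.
  rewrite (expand_det_row e 0) (sum2 _ 0) /cofactor !det_mx11 !mxE /=.
  rewrite expr0 mul1r expr1 mulN1r mulrN.
  by congr (_ * e _ _ - _ * e _ _); apply: val_inj.
case: (ord2P 0 i) => -> //; rewrite rev_ordK; ring.
Qed.

Lemma rank1_mx_rank (K : fieldType) (e : 'M[K]_2) : rank1_mx e -> \rank e = 1%N.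
Proof.
move=> h; have [t d] := h 0.
have e0 : e != 0.
  by apply/eqP => e0; move: t; rewrite e0 !mxE addr0 => /esym/eqP; rewrite oner_eq0.
have : ~~ row_free e.
  by rewrite row_free_unit unitmxE (det2 e 0) d subrr unitr0.
rewrite /row_free => n2; apply/eqP; rewrite eqn_leq lt0n mxrank_eq0 e0 andbT.
by rewrite -ltnS ltn_neqAle n2 rank_leq_row.
Qed.

(** The determinants of [e] and [1 - e] are idempotents vanishing at all field-valued points, hence
    0; and det(1 - e) = 1 - tr e + det e gives the trace. *)
Lemma idempotent_rank1 (R : comPzRingType) (e : 'M[R]_2) : e *m e = e ->
  (forall (K : fieldType) (f : {rmorphism R -> K}), \rank (map_mx f e) = 1%N) ->
  rank1_mx e.
Proof.
move=> ee re; have det0 : \det e = 0.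
  apply: idempotent_eq0 => [|K f]; first by rewrite -det_mulmx ee.
  rewrite -det_map_mx; apply/eqP; rewrite -[_ == 0]negbK -unitfE -unitmxE.
  by rewrite -row_free_unit /row_free re.
have det1 : \det (1%:M - e) = 0.
  apply: idempotent_eq0 => [|K f].
    by rewrite -det_mulmx mulmxBl mul1mx mulmxBr mulmx1 ee subrr subr0.
  rewrite -det_map_mx; apply/eqP; rewrite -[_ == 0]negbK -unitfE -unitmxE.
  apply/negP => u.
  have : map_mx f (1%:M - e) *m map_mx f e = 0.
    by rewrite -map_mxM mulmxBl mul1mx ee subrr map_mx0.
  move/(congr1 (mulmx (invmx (map_mx f (1%:M - e))))).
  rewrite mulKmx // mulmx0 => e0.
  by have := re K f; rewrite e0 mxrank0.
move: det0 det1; rewrite !(det2 _ 0) !mxE eqxx /= => d0 d1.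
apply: (@rank1_mxW _ _ 0); last by apply/eqP; rewrite -subr_eq0 d0.
apply/eqP; rewrite eq_sym -subr_eq0 -d1 -[X in _ == X]subr0 -d0; apply/eqP.
ring.
Qed.

(** The two equations say that [v] is proportional to each row of [e]. *)
Lemma mem_rank1_mx (R : comPzRingType) (e : 'M[R]_2) (v : 'rV[R]_2) i :
  rank1_mx e ->
  (v *m e = v <->
   v 0 (o i) * e (o i) i = v 0 i * e (o i) (o i) /\
   v 0 i * e i (o i) = v 0 (o i) * e i i).
Proof.
move=> h; have [t _] := h i.
have e1 : e (o i) (o i) = 1 - e i i by rewrite -t addrC addKr.
have e2 : e i i = 1 - e (o i) (o i) by rewrite -t addrK.
split=> [ve|[h1 h2]].
  split; [have /rowP/(_ i) := ve|have /rowP/(_ (o i)) := ve]; rewrite mxE (sum2 _ i).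
    by move=> e'; rewrite e1 mulrBr mulr1 -[X in _ = X - _]e' addrAC subrr add0r.
  by move=> e'; rewrite e2 mulrBr mulr1 -[X in _ = X - _]e' addrK.
apply/rowP => l; rewrite mxE (sum2 _ i).
case: (ord2P i l) => ->; first by rewrite h1 -mulrDr t mulr1.
by rewrite h2 -mulrDr t mulr1.
Qed.

Lemma line_rank1_mx (R : comPzRingType) (e : 'M[R]_2) :
  rank1_mx e -> line (fun v => v *m e = v).
Proof.
move=> h; exists e; split=> // [|K f]; first exact: rank1_mx_idem.
exact/rank1_mx_rank/rank1_mx_map.
Qed.

Definition proj_line (R : comPzRingType) (e : 'M[R]_2) (h : rank1_mx e) :
  PN 1 R := exist _ _ (line_rank1_mx h).

Lemma line2P (R : comPzRingType) (x : PN 1 R) :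
  exists e (h : rank1_mx e), x = proj_line h.
Proof.
case: x => L [e [ee Le re]]; exists e, (idempotent_rank1 ee re).
exact: line_ext.
Qed.

Lemma fmap_proj_line (R S : comPzRingType) (f : {rmorphism R -> S})
    (e : 'M[R]_2) (h : rank1_mx e) :
  fmap (PN 1) f (proj_line h) = proj_line (rank1_mx_map f h).
Proof.
by apply: line_ext => v; apply: fmap_line => //; apply: rank1_mx_idem.
Qed.

Definition pair_rv (R : comPzRingType) (i : 'I_2) (a b : R) : 'rV[R]_2 :=
  \row_j if j == i then a else b.

Lemma pair_rv1 (R : comPzRingType) i (a b : R) : pair_rv i a b 0 i = a.
Proof. by rewrite mxE eqxx. Qed.

Lemma pair_rv2 (R : comPzRingType) i (a b : R) : pair_rv i a b 0 (o i) = b.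
Proof. by rewrite mxE rev_ord_neq. Qed.

Definition chart_mx (R : comPzRingType) (i : 'I_2) (t : R) : 'M[R]_2 :=
  \matrix_(j, l) if j == i then (if l == i then 1 else t) else 0.

Lemma chart_mxP (R : comPzRingType) (i : 'I_2) (t : R) : rank1_mx (chart_mx i t).
Proof.
by apply: (@rank1_mxW _ _ i); rewrite !mxE eqxx rev_ord_neq ?addr0 ?mulr0.
Qed.

(** The point with homogeneous coordinate 1 at [i] and [t] at the other index; thus [chart (o 0) 0]
    is [0 : 1], the point at infinity. *)
Definition chart (R : comPzRingType) (i : 'I_2) (t : R) : PN 1 R :=
  proj_line (chart_mxP i t).

Lemma mem_chart (R : comPzRingType) i (t : R) v :
  sval (chart i t) v <-> v 0 (o i) = v 0 i * t.
Proof.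
apply: iff_trans (mem_rank1_mx v i (chart_mxP i t)) _.
rewrite !mxE eqxx rev_ord_neq !mulr0 mulr1.
by split=> [[_ ->]|->].
Qed.

Lemma fmap_chart (R S : comPzRingType) (f : {rmorphism R -> S}) i (t : R) :
  fmap (PN 1) f (chart i t) = chart i (f t).
Proof.
rewrite fmap_proj_line; apply: line_ext => v /=.
suff -> : map_mx f (chart_mx i t) = chart_mx i (f t) by [].
apply/matrixP => j l; rewrite !mxE; case: ifP => _; last by rewrite rmorph0.
by case: ifP => _; rewrite ?rmorph1.
Qed.

Lemma chart_inj (R : comPzRingType) i : injective (@chart R i).
Proof.
move=> t t' e; have : sval (chart i t') (pair_rv i 1 t).
  by rewrite -e; apply/mem_chart; rewrite pair_rv1 pair_rv2 mul1r.
by move/mem_chart; rewrite pair_rv1 pair_rv2 mul1r.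
Qed.

(** A rank 1 summand containing a vector with an entry 1 is spanned by that vector. *)
Lemma chartP (R : comPzRingType) i (t : R) (x : PN 1 R) :
  sval x (pair_rv i 1 t) -> x = chart i t.
Proof.
have [e [h ->]] := line2P x; have [tr _] := h i.
move=> /(mem_rank1_mx _ i h); rewrite pair_rv1 pair_rv2 !mul1r => -[h1 h2].
apply: line_ext => v; apply: iff_trans (iff_sym (mem_chart i t v)).
apply: iff_trans (mem_rank1_mx v i h) _; rewrite -h1 h2.
split=> [[h3 h4]|->]; last by split; ring.
transitivity (v 0 (o i) * e i i + (v 0 (o i) * e (o i) i) * t).
  by rewrite -mulrA [e (o i) i * t]mulrC h1 -mulrDr tr mulr1.
rewrite -h4 h3; have -> : e i i = 1 - t * e (o i) i by rewrite h1 -tr addrK.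
ring.
Qed.

(** The combination of the rows of [e] with coefficients [u] and [v] lies in the line and has [i]-th
    entry 1; its other entry is the coordinate. So chart [i] is the locus where column [i] of [e]
    generates the unit ideal. *)
Lemma chart_of_unit (R : comPzRingType) i (e : 'M[R]_2) (h : rank1_mx e) u v :
  e i i * u + e (o i) i * v = 1 ->
  proj_line h = chart i (e i (o i) * u + e (o i) (o i) * v).
Proof.
move=> euv; have [_ d] := h i.
apply/chartP/(mem_rank1_mx _ i h); rewrite pair_rv1 pair_rv2 !mul1r.
split; [rewrite -[RHS]mulr1|rewrite -[LHS]mulr1]; rewrite -euv.
  transitivity (e i (o i) * e (o i) i * u + e (o i) (o i) * e (o i) i * v); first ring.
  by rewrite -d; ring.
transitivity (e i (o i) * e i i * u + e i (o i) * e (o i) i * v); first ring.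
by rewrite -d; ring.
Qed.

Lemma chart_unit (R : comPzRingType) i (e : 'M[R]_2) (h : rank1_mx e) t :
  proj_line h = chart i t -> e i i + t * e (o i) i = 1.
Proof.
move=> eq; have : sval (proj_line h) (pair_rv i 1 t).
  by rewrite eq; apply/mem_chart; rewrite pair_rv1 pair_rv2 mul1r.
move=> /(mem_rank1_mx _ i h); rewrite pair_rv1 pair_rv2 !mul1r => -[-> _].
by have [] := h i.
Qed.

Lemma unit_ideal2 (R S : comPzRingType) (f : {rmorphism R -> S}) (p q : R) :
  unit_ideal (fun s => exists2 a, a = p \/ a = q & s = f a) <->
  exists u v, f p * u + f q * v = 1.
Proof.
split=> [h|[u [v e]]].
  apply: (gen_sub (J := fun z => exists u v, f p * u + f q * v = z)) h.
    split=> [|_ _ [u [v <-]] [u' [v' <-]]|c _ [u [v <-]]].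
    - by exists 0, 0; rewrite !mulr0 addr0.
    - by exists (u + u'), (v + v'); ring.
    by exists (c * u), (c * v); ring.
  move=> _ [_ [->|->] ->].
    by exists 1, 0; rewrite mulr1 mulr0 addr0.
  by exists 0, 1; rewrite mulr1 mulr0 add0r.
set J := (fun s => _); have [_ hD hM] := gen_ideal J.
rewrite /unit_ideal -/(gen J 1) -e.
by apply: hD; rewrite mulrC; apply/hM/gen_in; [exists p|exists q]; auto.
Qed.

(** * The projective line *)

Lemma image_stable (X Y : functor) (f : mor X Y) : stable (image f).
Proof. by move=> R S g y [x <-]; exists (fmap X g x); rewrite app_nat. Qed.

Section ProjectiveLine.
Variable k : fieldType.

Definition P1 : functor := prod_fun (PN 1) (Sp k).

Definition P1_str : mor P1 (Sp k) := @Mor P1 (Sp k) (fun R x => x.2) (fun _ _ _ _ => erefl).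

Definition chart_app (i : 'I_2) (R : comPzRingType) (f : Sp {poly k} R) : P1 R :=
  (chart i (f 'X), rcomp f polyC).

Lemma chart_nat i (R S : comPzRingType) (f : {rmorphism R -> S})
    (x : Sp {poly k} R) :
  chart_app i (fmap (Sp {poly k}) f x) = fmap P1 f (chart_app i x).
Proof.
by apply: (congr2 pair); [apply/esym/fmap_chart|apply: rmorph_ext].
Qed.

Definition chart_mor (i : 'I_2) : mor (Sp {poly k}) P1 := Mor (@chart_nat i).

Lemma chart_mor_inj i (R : comPzRingType) : injective (@app _ _ (chart_mor i) R).
Proof.
move=> f g e; apply: poly_rmorph_ext => [|c].
  exact: chart_inj (congr1 fst e).
exact: (congr1 (fun h : {rmorphism _ -> _} => h c) (congr1 snd e)).
Qed.

Lemma image_chart i (R : comPzRingType) (x : P1 R) :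
  image (chart_mor i) x <-> exists t, x.1 = chart i t.
Proof.
split=> [[f <-]|]; first by exists (f 'X).
case: x => y rho [t /= ->]; exists (ev rho t).
apply: (congr2 pair); first by rewrite evX.
by apply: rmorph_ext => c; apply: evC.
Qed.

Lemma chart_mor_open i : open_immersion (chart_mor i).
Proof.
split=> [R|]; first exact: chart_mor_inj.
split=> [|R [y rho]]; first exact: image_stable.
have [e [h ->]] := line2P y.
exists (fun a => a = e i i \/ a = e (o i) i) => S f.
apply: iff_trans (image_chart _ _) _; apply: iff_trans (iff_sym (unit_ideal2 _ _ _)).
rewrite [(_, _).1]fmap_proj_line; split=> [[t /chart_unit]|[u [v euv]]].
  by rewrite !mxE => et; exists 1, t; rewrite mulr1 [_ * t]mulrC.
eexists; apply: (@chart_of_unit _ i _ _ u v); rewrite !mxE; exact: euv.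
Qed.

Lemma line_in_chart (K : fieldType) (y : PN 1 K) : exists i t, y = chart i t.
Proof.
have [e [h ->]] := line2P y.
have [e0|e0] := eqVneq (e 0 0) 0; last first.
  exists 0; eexists; apply: (@chart_of_unit _ 0 _ _ (e 0 0)^-1 0).
  by rewrite mulr0 addr0 mulfV.
exists (o 0); eexists; apply: (@chart_of_unit _ (o 0) _ _ 1 0).
by have [] := h 0; rewrite e0 add0r mulr0 addr0 mulr1.
Qed.

Lemma P1_cover : open_cover chart_mor.
Proof.
split=> [i|K x]; first exact: chart_mor_open.
have [i [t e]] := line_in_chart x.1; exists i.
by apply/image_chart; exists t.
Qed.

Lemma P1_scheme : is_scheme P1.
Proof.
split; first exact: prod_sheaf (@PN_sheaf 1) (@Sp_sheaf k).
by exists 'I_2, (fun=> {poly k} : comPzRingType), chart_mor; apply: P1_cover.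
Qed.

Lemma P1_projective : projective P1_str.
Proof.
exists 1%N, (@Mor P1 (PN 1) (fun R x => x.1) (fun _ _ _ _ => erefl)).
split=> [R [x r] [x' r'] //|]; split=> [|R x]; first exact: image_stable.
exists (fun=> False) => S f; split=> // _.
by exists (fmap P1 f x).
Qed.

Lemma P1_lft : locally_finite_type P1_str.
Proof.
exists 'I_2, (fun=> {poly k} : comPzRingType), chart_mor; split; first exact: P1_cover.
move=> i; exists 1%N, (fun=> 'X) => P hC hX hD hM.
elim/poly_ind => [|p c IH]; first exact: (hC 0).
by apply: hD; [apply: hM; last exact: (hX 0)|exact: (hC c)].
Qed.

(* A lift of an idempotent with trace 1 can be corrected by a multiple of its
   determinant, which has square zero. *)
Lemma PN1_lift (R R0 : comPzRingType) (f : {rmorphism R -> R0}) (x0 : PN 1 R0) :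
  (forall y, exists a, f a = y) ->
  (forall a b, f a = 0 -> f b = 0 -> a * b = 0) ->
  exists x, fmap (PN 1) f x = x0.
Proof.
move=> fs f0; have [e [h ->]] := line2P x0; have [tr dt] := h 0.
have [a ea] := fs (e 0 0); have [b eb] := fs (e 0 (o 0)); have [c ec] := fs (e (o 0) 0).
pose d := 1 - a.
have ed : f d = e (o 0) (o 0) by rewrite rmorphB rmorph1 ea -tr addrAC subrr add0r.
pose D := a * d - b * c.
have fD : f D = 0 by rewrite rmorphB !rmorphM ea ed eb ec dt subrr.
have DD : D * D = 0 by apply: f0.
(* For e the lift with entries a, b, c, d this is e + (2e - 1)D. As e^2 = e - D, it is the Newton
   step 3e^2 - 2e^3 towards an idempotent. *)
pose e' : 'M[R]_2 := \matrix_(i, j)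
  if i == 0 then (if j == 0 then a + (a - d) * D else b + b * D *+ 2)
  else (if j == 0 then c + c * D *+ 2 else d - (a - d) * D).
have h' : rank1_mx e'.
  apply: (@rank1_mxW _ _ 0); rewrite !mxE !eqxx !rev_ord_neq; first by rewrite /d; ring.
  apply/eqP; rewrite -subr_eq0; apply/eqP.
  suff -> : (a + (a - d) * D) * (d - (a - d) * D) - (b + b * D *+ 2) * (c + c * D *+ 2) =
      D * D * (1 *+ 3 + D *+ 4) by rewrite DD mul0r.
  rewrite /D /d; ring.
exists (proj_line h'); rewrite fmap_proj_line; apply: line_ext => v /=.
suff -> : map_mx f e' = e by [].
apply/matrixP => i j; rewrite !mxE.
have fe (u : R) n : f (u * D *+ n) = 0 by rewrite rmorphMn rmorphM fD mulr0 mul0rn.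
case: (ord2P 0 i) (ord2P 0 j) => -> [] ->; rewrite ?eqxx ?rev_ord_neq.
- by rewrite rmorphD ea (fe _ 1%N) addr0.
- by rewrite rmorphD eb fe addr0.
- by rewrite rmorphD ec fe addr0.
by rewrite rmorphB ed (fe _ 1%N) subr0.
Qed.

Lemma P1_formally_smooth : formally_smooth P1_str.
Proof.
move=> R R0 f fs f0 rho [y0 rho0] /= e.
by have [y <-] := PN1_lift y0 fs f0; exists (y, rho); rewrite e.
Qed.

Lemma P1_smooth : smooth P1_str.
Proof. by split; [exact: P1_lft|exact: P1_formally_smooth]. Qed.

End ProjectiveLine.

Lemma point_fmap (B : comPzRingType) (X : functor) (u : mor (Sp B) X)
    (R : comPzRingType) (f : {rmorphism B -> R}) :
  u R f = fmap X f (u B (rid B)).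
Proof. by rewrite -app_nat; congr (u R _); apply: rmorph_ext. Qed.

Lemma open_pullback (B : comPzRingType) (X : functor) (u : mor (Sp B) X)
    (U : subset_of X) : is_open U ->
  exists I : B -> Prop, forall (K : fieldType) (f : {rmorphism B -> K}),
    U K (u K f) <-> exists2 a, I a & f a != 0.
Proof.
case=> _ /(_ B (u B (rid B)))[I hI]; exists I => K f.
rewrite point_fmap; apply: iff_trans (hI K f) _; split=> [|[a Ia fa]].
  by move=> /unit_idealP/(_ K (rid K))[_ [a Ia ->] fa]; exists a.
by apply/unit_idealP => F g; exists (f a); [exists a|rewrite fmorph_eq0].
Qed.

Lemma irreducible_image (X Y : functor) (m : mor X Y) :
  (forall (K : fieldType) (y : Y K), exists x, m K x = y) ->
  irreducible X -> irreducible Y.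
Proof.
move=> ms [[K [x _]] hX]; split; first by exists K, (m K x).
move=> U V hU hV [L [y [_ Uy]]] [L' [y' [_ Vy']]].
have [||F [z [_ Uz Vz]]] := hX _ _ (open_preimage m hU) (open_preimage m hV).
- by have [z e] := ms L y; exists L, z; rewrite e.
- by have [z e] := ms L' y'; exists L', z; rewrite e.
by exists F, (m F z).
Qed.

(** The constant [False] would not be open: every open subfunctor contains all points over the zero
    ring. *)
Lemma empty_open (X : functor) : is_open (fun R (x : X R) => (1 : R) = 0).
Proof.
split=> [R S f x e|R x]; first by rewrite -(rmorph1 f) e rmorph0.
exists (fun=> False) => S f; split=> [e|[n [a [b [h <-]]]]].
  by exists 0%N, (fun=> 0), (fun=> 0); split=> [[]//|]; rewrite big_ord0.
by rewrite big1 // => i; case: (h i).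
Qed.

Lemma chart_swap (R : comPzRingType) i (t s : R) :
  t * s = 1 -> chart i t = chart (o i) s.
Proof.
move=> e; apply: line_ext => v; apply: iff_trans (mem_chart _ _ _) _.
apply: iff_trans _ (iff_sym (mem_chart _ _ _)); rewrite rev_ordK.
by split=> ->; rewrite -mulrA ?e 1?[s * t]mulrC ?e mulr1.
Qed.

Lemma chart0_meet (R : comPzRingType) i (t : R) : chart (o i) 0 = chart i t -> 1 = 0 :> R.
Proof.
move=> e; have : sval (chart (o i) 0) (pair_rv i 1 t).
  by rewrite e; apply/mem_chart; rewrite pair_rv1 pair_rv2 mul1r.
by move/mem_chart; rewrite rev_ordK pair_rv1 mulr0.
Qed.

Lemma not_in_chart (K : fieldType) i (y : PN 1 K) :
  y = chart (o i) 0 <-> ~ exists t, y = chart i t.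
Proof.
split=> [-> [t /chart0_meet /eqP]|h]; first by rewrite oner_eq0.
have [j [t e]] := line_in_chart y; case: (ord2P i j) e => -> e.
  by case: h; exists t.
have [t0|t0] := eqVneq t 0; first by rewrite e t0.
case: h; exists t^-1; rewrite e (@chart_swap _ (o i) t t^-1) ?rev_ordK //.
by rewrite mulfV.
Qed.

(** * Homogenization, the generic point and the dimension *)

Section Homogenize.
Variables (k : comNzRingType) (h : {poly k}).

(** For nonzero [h] the degree is [size h], one more than that of [h]: this is x times the usual
    homogenization. The extra factor accounts for the numerator of order 1 in [P1_ordP]. *)
Definition homog (R : comPzRingType) (rho : {rmorphism k -> R}) (x y : R) : R :=
  wsum rho (fun n => x ^+ (size h - n) * y ^+ n) h.

Lemma homogE (R : comPzRingType) (rho : {rmorphism k -> R}) (x t : R) :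
  homog rho x (t * x) = x ^+ size h * ev rho t h.
Proof.
rewrite /homog /ev /= /peval /wsum mulr_sumr; apply: eq_bigr => i _.
have -> : x ^+ size h = x ^+ (size h - i) * x ^+ i.
  by rewrite -exprD subnK // ltnW.
by rewrite exprMn; ring.
Qed.

Lemma rmorph_homog (R S : comPzRingType) (f : {rmorphism R -> S})
    (rho : {rmorphism k -> R}) (x y : R) :
  f (homog rho x y) = homog (rcomp f rho) (f x) (f y).
Proof.
rewrite /homog /wsum rmorph_sum; apply: eq_bigr => i _.
by rewrite !rmorphM !rmorphXn.
Qed.

End Homogenize.

Section Dimension.
Variable k : fieldType.
Local Notation P1 := (P1 k).
Local Notation F := {fraction {poly k}}.

Definition generic : {rmorphism {poly k} -> F} := @tofrac _.

Lemma generic_eq0 a : (generic a == 0) = (a == 0).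
Proof. exact: tofrac_eq0. Qed.

Lemma open_generic_chart (U : subset_of P1) i (L : fieldType) (f : {rmorphism {poly k} -> L}) :
  is_open U -> U L (chart_mor k i L f) -> U F (chart_mor k i F generic).
Proof.
move=> /(open_pullback (chart_mor k i))[I hI] /hI[a Ia fa].
apply/hI; exists a => //; rewrite generic_eq0.
by apply: contraNneq fa => ->; rewrite rmorph0.
Qed.

Lemma chart_eq_mor i (R : comPzRingType) (x : P1 R) t :
  x.1 = chart i t -> exists f, x = chart_mor k i R f.
Proof.
by move=> e; have [|f] := (image_chart i x).2; [exists t|exists f].
Qed.

(** In either chart a nonempty open set is nonzero at the generic point; the charts are linked by
    rewriting the generic point of one with coordinate 1/X in the other. *)
Lemma open_generic (U : subset_of P1) i (K : fieldType) (x : P1 K) :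
  is_open U -> U K x -> U F (chart_mor k i F generic).
Proof.
move=> hU Ux; have [j [t /chart_eq_mor[f e]]] := line_in_chart x.1.
move: Ux; rewrite e => /(open_generic_chart hU).
case: (ord2P i j) => -> // Uj.
have X0 : generic 'X != 0 by rewrite generic_eq0 polyX_eq0.
have [|g eg] := @chart_eq_mor i F (chart_mor k (o i) F generic) (generic 'X)^-1.
  by rewrite /= (@chart_swap _ (o i) (generic 'X) (generic 'X)^-1) ?rev_ordK // mulfV.
by move: Uj; rewrite eg => /(open_generic_chart hU).
Qed.

Lemma P1_irreducible : irreducible P1.
Proof.
split; first by exists k, (chart 0 0, rid k).
move=> U V hU hV [K [x [_ Ux]]] [K' [y [_ Vy]]].
exists F, (chart_mor k 0 F generic); split=> //.
  exact: open_generic Ux.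
exact: open_generic Vy.
Qed.

(** Every field-valued point of this set extends one [k]-point, and membership in an open subfunctor
    descends to that point. *)
Lemma infty_irreducible i :
  irreducible_set (fun (K : fieldType) (x : P1 K) => x.1 = chart i 0).
Proof.
pose p : P1 k := (chart i 0, rid k).
have hp (U : subset_of P1) (K : fieldType) (x : P1 K) :
    is_open U -> x.1 = chart i 0 -> U K x -> U k p.
  case: x => y rho hU /= -> Ux; apply: (open_descent (f := rho) hU).
    by apply/eqP; rewrite oner_neq0.
  have -> : fmap P1 rho p = (chart i 0, rho); last exact: Ux.
  apply: (congr2 pair); first by rewrite fmap_chart rmorph0.
  exact: rmorph_ext.
split; first by exists k, p.
move=> U V hU hV [K [x [ex Ux]]] [K' [y [ey Vy]]].
by exists k, p; split=> //; [apply: hp Ux|apply: hp Vy].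
Qed.

Lemma chart_open i : is_open (image (chart_mor k i)).
Proof. by case: (chart_mor_open k i). Qed.

Lemma P1_chain1 : has_chain P1 1.
Proof.
exists (fun i => if i is 0 then fun K x => x.1 = chart (o 0) 0 else fun _ _ => True).
split=> [[|i] _|[|//] _]; split.
- exists (image (chart_mor k 0)); split; first exact: chart_open.
  move=> K x; apply: iff_trans (not_in_chart _ _) _.
  by split=> h /image_chart.
- exact: infty_irreducible.
- exists (fun (R : comPzRingType) (_ : P1 R) => (1 : R) = 0); split=> [|K x]; first exact: empty_open.
  by split=> // _ /eqP; rewrite oner_eq0.
- exact: P1_irreducible.
- by [].
exists k, (chart 0 0, rid k); split=> // /esym /chart0_meet /eqP.
by rewrite oner_eq0.
Qed.

Definition chart_nonvanishing i (h : {poly k}) : subset_of P1 := fun R x =>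
  exists f, x = chart_mor k i R f /\ exists u, f h * u = 1.

(* The nonvanishing locus is cut out by the homogenization of h, evaluated at
   the two rows of an idempotent matrix. *)
Lemma chart_nonvanishing_open i h : is_open (chart_nonvanishing i h).
Proof.
split=> [R S g _ [f [-> [u e]]]|R [y rho]].
  exists (rcomp g f); split; first by rewrite -app_nat.
  by exists (g u); rewrite /rcomp /= -rmorphM e rmorph1.
have [e [he ->]] := line2P y.
(* The first factors place D(p, q) inside chart [i]. There each row of [e] is a multiple of (1, t),
   so [p] and [q] are h(t) times powers of the entries of column [i]. *)
pose p := e i i * homog h rho (e i i) (e i (o i)).
pose q := e (o i) i * homog h rho (e (o i) i) (e (o i) (o i)).
exists (fun a => a = p \/ a = q) => S g.
apply: iff_trans _ (iff_sym (unit_ideal2 g p q)).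
have key t : proj_line (rank1_mx_map g he) = chart i t ->
    g p = g (e i i) ^+ (size h).+1 * ev (rcomp g rho) t h /\
    g q = g (e (o i) i) ^+ (size h).+1 * ev (rcomp g rho) t h.
  move=> et; have : sval (proj_line (rank1_mx_map g he)) (pair_rv i 1 t).
    by rewrite et; apply/mem_chart; rewrite pair_rv1 pair_rv2 mul1r.
  move=> /(mem_rank1_mx _ i (rank1_mx_map g he)).
  rewrite pair_rv1 pair_rv2 !mul1r !mxE => -[e1 e2].
  by rewrite !rmorphM !rmorph_homog e2 -e1 !homogE !exprS !mulrA.
split=> [[f [ef [u eu]]]|[u [v euv]]].
  have et : proj_line (rank1_mx_map g he) = chart i (f 'X).
    exact: etrans (esym (fmap_proj_line g he)) (congr1 fst ef).
  have efv : f = ev (rcomp g rho) (f 'X).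
    apply: poly_rmorph_ext => [|c]; first by rewrite evX.
    rewrite evC; exact: (congr1 (fun z : P1 S => z.2 c) (esym ef)).
  have [ep eq] := key _ et; apply/unit_ideal2/unit_idealP => K j.
  have fh : j (f h) != 0.
    by apply: contraTneq isT => z; have /eqP := congr1 j eu;
      rewrite rmorphM z mul0r rmorph1 eq_sym oner_eq0.
  have := chart_unit et; rewrite !mxE => /(congr1 j); rewrite rmorph1 rmorphD rmorphM.
  have [z|nz _] := eqVneq (j (g (e i i))) 0.
    rewrite z add0r => z'; exists (g q); first by exists q; [right|].
    rewrite eq rmorphM rmorphXn -efv mulf_neq0 // expf_neq0 //.
    by apply: contra_eq_neq z' => ->; rewrite mulr0 eq_sym oner_neq0.
  exists (g p); first by exists p; [left|].
  by rewrite ep rmorphM rmorphXn -efv mulf_neq0 // expf_neq0.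
have [t et] : exists t, proj_line (rank1_mx_map g he) = chart i t.
  eexists; apply: (@chart_of_unit _ i _ _ (g (homog h rho (e i i) (e i (o i))) * u)
    (g (homog h rho (e (o i) i) (e (o i) (o i))) * v)).
  by rewrite !mxE !mulrA -!rmorphM.
exists (ev (rcomp g rho) t); split.
  apply: (congr2 pair); first by rewrite evX -et fmap_proj_line.
  by apply: rmorph_ext => c; rewrite [RHS]evC.
have [ep eq] := key _ et.
exists (g (e i i) ^+ (size h).+1 * u + g (e (o i) i) ^+ (size h).+1 * v).
by rewrite -euv ep eq; ring.
Qed.

(* m generates the kernel of f. *)
Lemma kernel_factor (L : fieldType) (f : {rmorphism {poly k} -> L}) (a : {poly k}) :
  a != 0 -> f a = 0 ->
  exists (m h : {poly k}) (e : nat),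
    [/\ f m = 0, forall b, f b = 0 -> m %| b, f h != 0 & a = m ^+ e * h].
Proof.
move=> a0 fa.
have ex : exists n, `[< exists2 m : {poly k}, size m = n & m != 0 /\ f m = 0 >].
  by exists (size a); apply/asboolP; exists a.
case: (ex_minnP ex) => n /asboolP[m sm [m0 fm]] min.
have dvd b : f b = 0 -> m %| b.
  move=> fb; rewrite /dvdp; apply: contrapT => /negP r0.
  have fr : f (b %% m) = 0.
    have := congr1 f (divp_eq b m); rewrite fb rmorphD rmorphM fm mulr0 add0r.
    by move/esym.
  have /min : `[< exists2 m' : {poly k}, size m' = size (b %% m) & m' != 0 /\ f m' = 0 >].
    by apply/asboolP; exists (b %% m).
  by rewrite -sm leqNgt ltn_modp m0.
have sm1 : (1 < size m)%N.
  rewrite ltnNge; apply/negP => /size1_polyC em.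
  have c0 : m`_0 != 0 by rewrite em polyC_eq0 in m0.
  have := fmorph_eq0 (rcomp f (@polyC k) : {rmorphism k -> L}) m`_0.
  by rewrite /rcomp /= -em fm eqxx (negPf c0).
suff [h [e [fh ea]]] : exists (h : {poly k}) (e : nat), f h != 0 /\ a = m ^+ e * h.
  by exists m, h, e.
(* Divide by [m] until [f] no longer kills the quotient; sizes drop because [m] is not constant. *)
elim: (size a).+1 {-2}a (leqnn (size a).+1) a0 {fa ex} => // N IH b sb b0.
have [fb|fb] := eqVneq (f b) 0; last by exists b, 0%N; rewrite mul1r.
have /dvdpP[c ec] := dvd b fb.
have c0 : c != 0 by apply: contraNneq b0 => c0; rewrite ec c0 mul0r.
have [|h [e [fh eh]]] := IH c _ c0.
  apply: leq_trans (sb : (size b <= N)%N).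
  by rewrite ec size_mul // -subn1 ltn_subRL addnC ltn_add2l.
by exists h, e.+1; split=> //; rewrite ec eh exprS mulrC mulrA.
Qed.

(** Let m generate the polynomials vanishing at a point q of [Z 0] in a chart. Some nonzero a = m^e
    h vanishes on [Z 1], with h nonzero at q. Irreducibility of [Z 1] gives a point of it outside
    [Z 0] where h is invertible. There m vanishes, hence so does every polynomial vanishing at q,
    which contradicts being outside [Z 0]. *)
Lemma P1_no_chain2 : ~ has_chain P1 2.
Proof.
case=> Z [hZ hs].
have [[U0 [oU0 eU0]] [[L [q Zq]] _]] := hZ 0%N isT.
have [[U1 [oU1 eU1]] [_ irr1]] := hZ 1%N isT.
have [sub01 [K1 [p [Z1p nZ0p]]]] := hs 0%N isT.
have [_ [K2 [r [_ nZ1r]]]] := hs 1%N isT.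
have U0p : U0 K1 p by apply: contrapT => /eU0.
have U1r : U1 K2 r by apply: contrapT => /eU1.
have [i [t /chart_eq_mor[f ef]]] := line_in_chart q.1.
have [I1 hI1] := open_pullback (chart_mor k i) oU1.
have [I0 hI0] := open_pullback (chart_mor k i) oU0.
have /hI1[a Ia ga] := open_generic i oU1 U1r.
have a0 : a != 0 by apply: contraNneq ga => ->; rewrite rmorph0.
have vanish1 (K : fieldType) (g : {rmorphism {poly k} -> K}) :
    Z 1%N K (chart_mor k i K g) -> g a = 0.
  by move=> /eU1 nU; apply/eqP; apply: contrapT => /negP h; apply/nU/hI1; exists a.
have fa : f a = 0 by apply: vanish1; rewrite -ef; apply: sub01.
have [m [h [e [fm dvd fh ea]]]] := kernel_factor a0 fa.
have [||K3 [z [Z1z U0z [g [ez [u eu]]]]]] := irr1 U0 _ oU0 (chart_nonvanishing_open i h).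
- by exists K1, p.
- exists L, q; split; first exact: sub01.
  by exists f; split=> //; exists (f h)^-1; rewrite mulfV.
have gm : g m = 0.
  have : g a * u = 0 by rewrite vanish1 ?mul0r // -ez.
  rewrite ea rmorphM -mulrA eu mulr1 rmorphXn => /eqP.
  by rewrite expf_eq0 => /andP[_ /eqP].
move: U0z; rewrite ez => /hI0[b Ib] /eqP; apply.
have /dvd/dvdpP[c ->] : f b = 0.
  apply/eqP; apply: contrapT => /negP fb.
  have /eU0 := Zq; apply; rewrite ef; apply/hI0.
  by exists b.
by rewrite rmorphM gm mulr0.
Qed.

Lemma P1_dimension : has_dimension P1 1.
Proof. by split; [exact: P1_chain1|exact: P1_no_chain2]. Qed.

End Dimension.

Section Curve.
Variable k : fieldType.

Lemma P1_geometrically_irreducible : geometrically_irreducible (P1_str k).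
Proof.
move=> K i.
pose ap (R : comPzRingType) (x : P1 K R) : fprod (P1_str k) (Sp_mor i) R :=
  exist (fun z : P1 k R * Sp K R => P1_str k R z.1 = Sp_mor i R z.2)
    ((x.1, rcomp x.2 i), x.2) erefl.
have nat (R S : comPzRingType) (f : {rmorphism R -> S}) (x : P1 K R) :
    ap S (fmap (P1 K) f x) = fmap (fprod (P1_str k) (Sp_mor i)) f (ap R x).
  by apply: sig_ext; do 2!apply: (congr2 pair) => //; apply: rmorph_ext.
apply: (@irreducible_image _ _ (Mor nat)) (P1_irreducible K) => L [[[y r] g] e].
exists (y, g); apply: sig_ext; move: e => /= ->.
by do 2!apply: (congr2 pair) => //; apply: rmorph_ext.
Qed.

Definition P1_curve : curve k :=
  Curve (P1_scheme k) (P1_dimension k) (P1_smooth k) (P1_projective k)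
    P1_geometrically_irreducible.

End Curve.

(** * The point at infinity *)

Lemma proj_line_chart0 (R : comPzRingType) i (e : 'M[R]_2) (h : rank1_mx e) :
  proj_line h = chart (o i) 0 <-> e i i = 0 /\ e (o i) i = 0.
Proof.
split=> [eq|[e1 e2]].
  have mem l : sval (proj_line h) (row l e).
    by rewrite /= -row_mul rank1_mx_idem.
  have row0 l : e l i = 0.
    by have := mem l; rewrite eq => /mem_chart; rewrite rev_ordK mulr0 mxE.
  by split; apply: row0.
apply/chartP/(mem_rank1_mx _ i h).
have := pair_rv2 (o i) 1 (0 : R); rewrite rev_ordK pair_rv1 => ->.
by rewrite e1 e2 !mul0r mulr0.
Qed.

Lemma chart_chart (R : comPzRingType) i (s t : R) :
  chart (o i) s = chart i t -> t * s = 1.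
Proof.
move=> e; have : sval (chart (o i) s) (pair_rv i 1 t).
  by rewrite e; apply/mem_chart; rewrite pair_rv1 pair_rv2 mul1r.
by move/mem_chart; rewrite rev_ordK pair_rv1 pair_rv2 => ->.
Qed.

Lemma ev0_eq0 (k : comNzRingType) (b : {poly k}) :
  ev (rid k) 0 b = 0 <-> exists c, b = c * 'X.
Proof.
split=> [|[c ->]]; last by rewrite rmorphM evX mulr0.
elim/poly_ind: b => [_|p c _]; first by exists 0; rewrite mul0r.
by rewrite rmorphD rmorphM evX mulr0 add0r evC => c0; exists p; rewrite [c]c0 addr0.
Qed.

Lemma ideal_pow_X (k : comNzRingType) (b : {poly k}) i :
  ideal_pow (fun b => ev (rid k) 0 b = 0) i b <-> exists c, b = c * 'X^i.
Proof.
elim: i b => [|i IH] b /=; first by split=> // _; exists b; rewrite mulr1.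
split=> [[n [x [y [h ->]]]]|[c ->]].
  have hI : is_ideal (fun z : {poly k} => exists c : {poly k}, z = (c * 'X^(i.+1))%R).
    split=> [|_ _ [c ->] [d ->]|c _ [d ->]].
    - by exists 0; rewrite mul0r.
    - by exists (c + d); rewrite mulrDl.
    by exists (c * d); rewrite mulrA.
  apply: (ideal_sum hI) => j.
  have [/ev0_eq0[c ->] /IH[d ->]] := h j.
  by exists (c * d); rewrite exprS; ring.
exists 1%N, (fun=> 'X), (fun=> c * 'X^i); split=> [j|].
  by split; [apply/ev0_eq0; exists 1; rewrite mul1r|apply/IH; exists c].
by rewrite big_ord1 exprS mulrCA.
Qed.

Section PointAtInfinity.
Variable k : fieldType.
Local Notation P1 := (P1 k).

Definition infty_app (R : comPzRingType) (rho : Sp k R) : P1 R :=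
  (chart (o 0) 0, rho).

Lemma infty_nat (R S : comPzRingType) (f : {rmorphism R -> S}) (x : Sp k R) :
  infty_app (fmap (Sp k) f x) = fmap P1 f (infty_app x).
Proof. by apply: (congr2 pair) => //; rewrite fmap_chart rmorph0. Qed.

Definition P1_infty : mor (Sp k) P1 := Mor infty_nat.

Lemma image_infty (R : comPzRingType) (x : P1 R) :
  image P1_infty x <-> x.1 = chart (o 0) 0.
Proof.
split=> [[rho <-]//|]; case: x => y rho /= ->.
by exists rho.
Qed.

Lemma infty_closed_immersion : closed_immersion P1_infty.
Proof.
split=> [R x y e|]; first exact: (congr1 snd e).
split=> [|R [y rho]]; first exact: image_stable.
have [e [h ->]] := line2P y; exists (fun a => a = e 0 0 \/ a = e (o 0) 0) => S f.
apply: iff_trans (image_infty _) _; rewrite [_.1]fmap_proj_line.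
apply: iff_trans (proj_line_chart0 _ _) _; rewrite !mxE.
by split=> [[h1 h2] a [->|->]//|h']; split; apply: h'; auto.
Qed.

(** If column 0 of [e] did not generate the unit ideal, it would vanish at a field-valued point,
    which would then be the point at infinity. *)
Lemma off_inftyP (R : comPzRingType) (x : P1 R) :
  compl (image P1_infty) x <-> exists f, x = chart_mor k 0 R f.
Proof.
split=> [hx|[f ->] S g /image_infty]; last first.
  by rewrite -app_nat => /esym/chart0_meet.
suff [t e] : exists t, x.1 = chart 0 t.
  exact: chart_eq_mor e.
case: x hx => y rho; have [e [h ->]] := line2P y => hx.
suff [u [v euv]] : exists u v, rid R (e 0 0) * u + rid R (e (o 0) 0) * v = 1.
  by eexists; apply: (@chart_of_unit _ 0 _ _ u v).
apply/unit_ideal2/unit_idealP => K f; apply: contrapT => hn.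
have f0 a : a = e 0 0 \/ a = e (o 0) 0 -> f a = 0.
  by move=> ha; apply/eqP; apply: contrapT => /negP fa; apply: hn; exists a => //; exists a.
suff /eqP : (1 : K) = 0 by rewrite oner_eq0.
apply: (hx K f); apply/image_infty; rewrite [_.1]fmap_proj_line.
by apply/proj_line_chart0; rewrite !mxE; split; apply: f0; auto.
Qed.

Local Notation offP1 := (off P1_infty).

Definition affine_coord (R : comPzRingType) (x : offP1 R) : {rmorphism {poly k} -> R} :=
  sval (cid ((off_inftyP (sval x)).1 (svalP x))).

Lemma affine_coordP (R : comPzRingType) (x : offP1 R) :
  sval x = chart_mor k 0 R (affine_coord x).
Proof. exact: (svalP (cid ((off_inftyP (sval x)).1 (svalP x)))). Qed.

Lemma affine_coord_unique (R : comPzRingType) (x : offP1 R) f :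
  sval x = chart_mor k 0 R f -> affine_coord x = f.
Proof. by rewrite affine_coordP => /chart_mor_inj. Qed.

Lemma affine_coord_nat (R S : comPzRingType) (f : {rmorphism R -> S}) (x : offP1 R) :
  affine_coord (fmap offP1 f x) = rcomp f (affine_coord x).
Proof.
apply: affine_coord_unique.
by rewrite [LHS](_ : _ = fmap P1 f (sval x)) // affine_coordP -app_nat.
Qed.

Definition P1_function (a : {poly k}) : mor offP1 A1.
Proof.
exists (fun R x => affine_coord x a) => R S f x.
by rewrite affine_coord_nat.
Defined.

Definition off_chart (R : comPzRingType) (f : {rmorphism {poly k} -> R}) : offP1 R :=
  exist _ (chart_mor k 0 R f) ((off_inftyP _).2 (ex_intro _ f erefl)).

Lemma affine_coord_off_chart (R : comPzRingType) (f : {rmorphism {poly k} -> R}) :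
  affine_coord (off_chart f) = f.
Proof. exact: affine_coord_unique. Qed.

Lemma P1_function_inj a b : mor_eq (P1_function a) (P1_function b) -> a = b.
Proof.
by move=> /(_ _ (off_chart (rid {poly k}))); rewrite /= affine_coord_off_chart.
Qed.

(** Yoneda: a function is determined by its value at the universal point, the identity of
    [{poly k}]. *)
Lemma P1_function_surj (g : mor offP1 A1) : exists a, mor_eq (P1_function a) g.
Proof.
exists (g _ (off_chart (rid {poly k}))) => R x /=.
have {2}-> : x = fmap offP1 (affine_coord x) (off_chart (rid {poly k})).
  apply: sig_ext; rewrite affine_coordP.
  exact: point_fmap.
by rewrite app_nat.
Qed.

Lemma P1_kringP (l : k) (R : comPzRingType) (x : offP1 R) :
  P1_function l%:P R x = P1_str k R (sval x) l.
Proof. by rewrite affine_coordP. Qed.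

(** As [size a] is deg a + 1 for nonzero [a], this is -deg a. *)
Definition P1_ord (a : {poly k}) : int := 1%:Z - (size a)%:Z.

Lemma P1_ordP (a : {poly k}) : a != 0 -> has_order (P1_function a) (P1_ord a).
Proof.
(* With s = 1/T the coordinate at infinity, a(T) is homog(a)(s, 1) divided by s^(size a). *)
move=> a0; exists {poly k}, (chart_mor k (o 0)), (ev (rid k) 0),
  (homog a polyC 'X 1), ('X^(size a)), 1%N, (size a); split=> //.
- exact: chart_mor_open.
- apply: (congr2 pair); first by rewrite evX.
  by apply: rmorph_ext => c; apply: evC.
- split.
    split.
      apply/ideal_pow_X; exists (\sum_(i < size a) (a`_i)%:P * 'X^(size a - i.+1)).
      rewrite mulr_suml; apply: eq_bigr => i _.
      by rewrite expr1n mulr1 -mulrA -exprSr subnSK.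
    (* The coefficient of ['X] in the numerator is the leading coefficient of [a], so ['X^2] does
       not divide it. *)
    move=> /ideal_pow_X[c /(congr1 (fun p : {poly k} => p`_1))].
    rewrite coefMXn /= /homog /wsum coef_sum.
    have l0 : lead_coef a != 0 by rewrite lead_coef_eq0.
    move: l0; rewrite lead_coefE; case sa: (size a) => [|n] /= l0.
      by move/eqP: sa; rewrite size_poly_eq0 (negPf a0).
    rewrite big_ord_recr /= big1 => [|i _].
      rewrite add0r subSnn expr1n mulr1 coefCM coefX mulr1 => e.
      by rewrite e eqxx in l0.
    rewrite expr1n mulr1 coefCM coefXn subSn ?(ltnW (ltn_ord i)) // eqSS.
    by rewrite eq_sym subn_eq0 leqNgt ltn_ord mulr0.
  split.
    by apply/ideal_pow_X; exists 1; rewrite mul1r.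
  move=> /ideal_pow_X[c /(congr1 (fun p : {poly k} => p`_(size a)))] /eqP.
  by rewrite coefXn coefMXn eqxx ltnSn oner_eq0.
(* The same point has coordinate T = [f 'X] in chart 0 and s = [h 'X] at infinity; [ts] is T s =
   1. *)
move=> R h hu /=; set x := exist _ _ _; pose f := affine_coord x.
have e : chart_mor k (o 0) R h = chart_mor k 0 R f by rewrite -affine_coordP.
have ts : f 'X * h 'X = 1 := chart_chart (congr1 fst e).
have ef : ev (rcomp h (@polyC k)) (f 'X) = f.
  apply: poly_rmorph_ext => [|c]; first by rewrite evX.
  by rewrite evC; exact: (congr1 (fun z : P1 R => z.2 c) e).
by rewrite rmorph_homog rmorph1 rmorphXn -ts homogE ef.
Qed.

Lemma free_of_rank1 (R : comPzRingType) : free_of_rank (rid R) 1.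
Proof.
exists (fun=> 1) => y; exists (\row__ y); split=> [|a ->].
  by rewrite big_ord1 mxE mulr1.
by apply/rowP => i; rewrite mxE big_ord1 mulr1 [i]ord1.
Qed.

Definition P1_pointed : pointed_curve k :=
  @PointedCurve k (P1_curve k) k P1_infty infty_closed_immersion 1
    (free_of_rank1 k) {poly k} P1_function
    (fun R x => rmorph1 (affine_coord x)) (fun a b R x => rmorphD (affine_coord x) a b)
    (fun a b R x => rmorphM (affine_coord x) a b)
    P1_function_inj P1_function_surj polyC P1_kringP P1_ord P1_ordP.

End PointAtInfinity.

(** * The squaring map *)

(* R[s]/(s^2 - t), where (a, b) stands for a + b s. *)
Definition quad (R : comPzRingType) (t : R) : Type := (R * R)%type.

Section QuadraticAlgebra.
Variables (R : comPzRingType) (t : R).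

Local Notation Q := (quad t).
HB.instance Definition _ := GRing.Zmodule.on Q.

Definition qmul (x y : Q) : Q :=
  (x.1 * y.1 + t * (x.2 * y.2), x.1 * y.2 + x.2 * y.1).

Lemma qmulA : associative qmul.
Proof. by move=> [a b] [c d] [e f]; congr pair; rewrite /=; ring. Qed.
Lemma qmulC : commutative qmul.
Proof. by move=> [a b] [c d]; congr pair; rewrite /=; ring. Qed.
Lemma qmul1 : left_id (1, 0) qmul.
Proof. by move=> [a b]; congr pair; rewrite /=; ring. Qed.
Lemma qmulD : left_distributive qmul +%R.
Proof. by move=> [a b] [c d] [e f]; congr pair; rewrite /=; ring. Qed.
HB.instance Definition _ :=
  GRing.Zmodule_isComPzRing.Build Q qmulA qmulC qmul1 qmulD.

Definition qconst (a : R) : Q := (a, 0).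

Lemma qconst_zmod : zmod_morphism qconst.
Proof. by move=> a b; congr pair; rewrite /= subr0. Qed.
Lemma qconst_monoid : monoid_morphism qconst.
Proof. by split=> // a b; congr pair; rewrite /=; ring. Qed.
HB.instance Definition _ := GRing.isZmodMorphism.Build R Q qconst qconst_zmod.
HB.instance Definition _ := GRing.isMonoidMorphism.Build R Q qconst qconst_monoid.

Definition qroot : Q := (0, 1).

Lemma qroot2 : qroot * qroot = qconst t.
Proof. by congr pair; rewrite /=; ring. Qed.

Lemma quadE (x : Q) : x = qconst x.1 + qconst x.2 * qroot.
Proof.
by case: x => a b; congr pair; rewrite /=; ring.
Qed.

Definition quad_const : {rmorphism R -> Q} := qconst.

Lemma quad_ext (S : comPzRingType) (f g : {rmorphism Q -> S}) :
  f qroot = g qroot -> rcomp f quad_const = rcomp g quad_const -> f = g.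
Proof.
move=> e1 e2; apply: rmorph_ext => x.
have e a : f (qconst a) = g (qconst a).
  exact: (congr1 (fun h : {rmorphism _ -> _} => h a) e2).
by rewrite [x]quadE !rmorphD !rmorphM !e e1.
Qed.

Lemma quad_lift (S : comPzRingType) (f : {rmorphism R -> S}) (s : S) :
  s * s = f t ->
  exists g : {rmorphism Q -> S}, g qroot = s /\ rcomp g quad_const = f.
Proof.
move=> es; pose g (x : Q) := f x.1 + f x.2 * s.
have gz : zmod_morphism g.
  by move=> [a b] [c d]; rewrite /g /= !rmorphB; ring.
have gm : monoid_morphism g.
  split=> [|[a b] [c d]]; first by rewrite /g /= rmorph1 rmorph0 mul0r addr0.
  by rewrite /g /= !rmorphD !rmorphM -es; ring.
pose gz' := GRing.isZmodMorphism.Build Q S g gz.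
pose gm' := GRing.isMonoidMorphism.Build Q S g gm.
exists (HB.pack_for {rmorphism Q -> S} g gz' gm'); split.
  by rewrite /= /g /= rmorph0 rmorph1 add0r mul1r.
by apply: rmorph_ext => a; rewrite /= /g /= rmorph0 mul0r addr0.
Qed.

Lemma quad_free : free_of_rank quad_const 2.
Proof.
exists (fun i => if i == 0 then 1 else qroot) => y.
exists (\row_i if i == 0 then y.1 else y.2); split=> [|a].
  rewrite big_ord_recl big_ord1 !mxE /= mulr1; exact: quadE.
rewrite big_ord_recl big_ord1 /= mulr1 => ey.
have -> : y = (a 0 0, a 0 (o 0)).
  rewrite ey [RHS]quadE; congr (_ + qconst (a 0 _) * _).
  exact: val_inj.
by apply/rowP => i; rewrite !mxE; case: (ord2P 0 i) => ->.
Qed.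

End QuadraticAlgebra.

(* If e has row space the line spanned by v, then sq_mx e has row space the line
   spanned by the squares of the entries of v: for e = u v with v u = 1 this is
   the expansion of (v u)^3 = 1. *)
Definition sq_mx (R : comPzRingType) (e : 'M[R]_2) : 'M[R]_2 :=
  \matrix_(i, j) (e i j ^+ 2 * (e i i + e (o i) (o i) *+ 3)).

Lemma sq_mxP (R : comPzRingType) (e : 'M[R]_2) : rank1_mx e -> rank1_mx (sq_mx e).
Proof.
move=> h; have [t d] := h 0.
apply: (@rank1_mxW _ _ 0); rewrite !mxE rev_ordK.
  have -> : e (o 0) (o 0) = 1 - e 0 0 by rewrite -t addrC addKr.
  ring.
transitivity ((e 0 0 * e (o 0) (o 0)) ^+ 2 *
  ((e 0 0 + e (o 0) (o 0) *+ 3) * (e (o 0) (o 0) + e 0 0 *+ 3))); first ring.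
by rewrite d; ring.
Qed.

(** [w] is proportional to all coordinatewise products of two vectors of [L]. This refers to the
    line alone, so squaring does not depend on the idempotent presenting it. *)
Definition sq_set (R : comPzRingType) (L : 'rV[R]_2 -> Prop) (w : 'rV[R]_2) : Prop :=
  forall v v', L v -> L v' ->
  w 0 0 * (v 0 (o 0) * v' 0 (o 0)) = w 0 (o 0) * (v 0 0 * v' 0 0).

Lemma sq_setP (R : comPzRingType) (e : 'M[R]_2) (h : rank1_mx e) w :
  sq_set (sval (proj_line h)) w <-> w *m sq_mx e = w.
Proof.
have [t d] := h 0.
split=> [hw|/(mem_rank1_mx w 0 (sq_mxP h))].
  have mem l : sval (proj_line h) (row l e).
    by rewrite /= -row_mul rank1_mx_idem.
  apply/(mem_rank1_mx w 0 (sq_mxP h)).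
  have := hw _ _ (mem 0) (mem 0); have := hw _ _ (mem (o 0)) (mem (o 0)).
  by rewrite !mxE !expr2 !mulrA => -> ->.
rewrite !mxE rev_ordK => -[w1 w2] v v'.
move=> /(mem_rank1_mx v 0 h)[v1 v2] /(mem_rank1_mx v' 0 h)[v1' v2'].
set a := e 0 0 in t d v2 v2' w1 w2; set d' := e (o 0) (o 0) in t d v1 v1' w1 w2.
have cube : a ^+ 2 * (a + d' *+ 3) + d' ^+ 2 * (d' + a *+ 3) = 1.
  have -> : d' = 1 - a by rewrite -t addrC addKr.
  ring.
(* The factor 1 is split as in [cube]: one part is handled by proportionality to row 0 of [e], the
   other by proportionality to row 1. *)
rewrite -[LHS]mulr1 -[RHS]mulr1 -cube.
transitivity (w 0 0 * ((v 0 (o 0) * a) * (v' 0 (o 0) * a)) * (a + d' *+ 3) +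
   w 0 0 * (d' ^+ 2 * (d' + a *+ 3)) * (v 0 (o 0) * v' 0 (o 0))); first ring.
rewrite -v2 -v2' -w1.
transitivity (w 0 0 * (e 0 (o 0) ^+ 2 * (a + d' *+ 3)) * (v 0 0 * v' 0 0) +
   w 0 (o 0) * ((v 0 (o 0) * e (o 0) 0) * (v' 0 (o 0) * e (o 0) 0)) * (d' + a *+ 3)); first ring.
rewrite v1 v1' w2; ring.
Qed.

Lemma sq_line (R : comPzRingType) (x : PN 1 R) : line (sq_set (sval x)).
Proof.
have [e [h ->]] := line2P x; case: (line_rank1_mx (sq_mxP h)) => e' [ee me re].
by exists e'; split=> // v; apply: iff_trans (sq_setP h v) (me v).
Qed.

Definition sq (R : comPzRingType) (x : PN 1 R) : PN 1 R := exist _ _ (sq_line x).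

Lemma sq_proj_line (R : comPzRingType) (e : 'M[R]_2) (h : rank1_mx e) :
  sq (proj_line h) = proj_line (sq_mxP h).
Proof. by apply: line_ext => v; apply: sq_setP. Qed.

Lemma fmap_sq (R S : comPzRingType) (f : {rmorphism R -> S}) (x : PN 1 R) :
  sq (fmap (PN 1) f x) = fmap (PN 1) f (sq x).
Proof.
have [e [h ->]] := line2P x; rewrite fmap_proj_line !sq_proj_line fmap_proj_line.
apply: line_ext => v /=; suff -> : sq_mx (map_mx f e) = map_mx f (sq_mx e) by [].
by apply/matrixP => i j; rewrite !mxE rmorphM rmorphXn rmorphD rmorphMn.
Qed.

Lemma sq_chart (R : comPzRingType) i (t : R) : sq (chart i t) = chart i (t ^+ 2).
Proof.
apply: chartP => v v' /mem_chart ev /mem_chart ev'.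
have := pair_rv1 i (1 : R) (t ^+ 2); have := pair_rv2 i (1 : R) (t ^+ 2).
case: (ord2P 0 i) ev ev' => ->; rewrite ?rev_ordK => -> -> -> ->; ring.
Qed.

(** The entries of column [i] of [sq_mx e] are multiples of those of column [i] of [e]; if the
    former generate the unit ideal, so do the latter. *)
Lemma sq_in_chart (R : comPzRingType) i (t : R) (x : PN 1 R) :
  sq x = chart i t -> exists s, x = chart i s.
Proof.
have [e [h ->]] := line2P x; rewrite sq_proj_line => /chart_unit; rewrite !mxE => u.
eexists; apply: (@chart_of_unit _ i e h (e i i * (e i i + e (o i) (o i) *+ 3))
  (t * e (o i) i * (e (o i) (o i) + e (o (o i)) (o (o i)) *+ 3))).
by rewrite -[RHS]u; ring.
Qed.

Section Squaring.
Variable k : fieldType.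
Local Notation P1 := (P1 k).
Local Notation sqX := (comp_poly 'X^2 : {rmorphism {poly k} -> {poly k}}).

Lemma sq_nat (R S : comPzRingType) (f : {rmorphism R -> S}) (x : P1 R) :
  (sq (fmap P1 f x).1, (fmap P1 f x).2) = fmap P1 f (sq x.1, x.2).
Proof. by apply: (congr2 pair) => //; apply: fmap_sq. Qed.

Definition sq_mor : mor P1 P1 := @Mor P1 P1 (fun R x => (sq x.1, x.2)) sq_nat.

Lemma sq_chart_mor i (R : comPzRingType) (f : {rmorphism {poly k} -> R}) :
  sq_mor R (chart_mor k i R f) = chart_mor k i R (rcomp f sqX).
Proof.
apply: (congr2 pair).
  by rewrite /= sq_chart comp_polyX rmorphXn.
by apply: rmorph_ext => c; rewrite /= comp_polyC.
Qed.

Lemma sq_over_base : @over_base k (P1_pointed k) (P1_pointed k) sq_mor.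
Proof. by []. Qed.

Lemma image_sq_chart i (R : comPzRingType) (x : P1 R) :
  image (chart_mor k i) x <-> image (chart_mor k i) (sq_mor R x).
Proof.
split=> [[f <-]|/image_chart[t /sq_in_chart h]]; last exact/image_chart.
by rewrite sq_chart_mor; eexists.
Qed.

Lemma sq_finite : @finite_mor k (P1_pointed k) (P1_pointed k) sq_mor.
Proof.
exists 'I_2, (fun=> {poly k} : comPzRingType), (fun=> {poly k} : comPzRingType),
  (chart_mor k), (chart_mor k), (fun=> sqX); split.
- exact: P1_cover.
- exact: chart_mor_open.
- by move=> i R x; apply: image_sq_chart.
- by move=> i R f; apply: sq_chart_mor.
move=> i; exists 2, (fun j => if j == 0 then 1 else 'X) => y.
exists (fun j => if j == 0 then even_poly y else odd_poly y).
rewrite big_ord_recl big_ord1 /= mulr1.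
by rewrite -[LHS]poly_even_odd.
Qed.

Lemma bijective_of (T T' : Type) (f : T -> T') :
  injective f -> (forall y, exists x, f x = y) -> bijective f.
Proof.
move=> inj /choice[g gK]; exists g => // x; exact: inj.
Qed.

(** The generic point lies in chart 0, with some coordinate t, and its fibre is the spectrum of
    K[s]/(s^2 - t). *)
Lemma sq_degree : @degree_is k (P1_pointed k) (P1_pointed k) sq_mor 2.
Proof.
move=> K x gen.
have [t ex] : exists t, x.1 = chart 0 t.
  apply/image_chart; apply: gen; first exact: chart_open.
  by exists k, (chart_mor k 0 k (ev (rid k) 0)); eexists.
pose h := quad_const t.
have hr : qroot t ^+ 2 = h t by rewrite expr2 qroot2.
have eqc (R : comPzRingType) (g : {rmorphism quad t -> R}) :
    sq_mor R (chart 0 (g (qroot t)), rcomp (rcomp g h) x.2) =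
    point_mor x R (rcomp g h).
  apply: (congr2 pair); last exact: rmorph_ext.
  by rewrite /= ex sq_chart -rmorphXn hr [RHS]fmap_chart.
pose ap R g : fprod sq_mor (point_mor x) R := exist (fun z : P1 R * Sp K R =>
  sq_mor R z.1 = point_mor x R z.2) (_, _) (eqc R g).
have nat (R S : comPzRingType) (f : {rmorphism R -> S}) g :
    ap S (rcomp f g) = fmap (fprod sq_mor (point_mor x)) f (ap R g).
  apply: sig_ext; apply: (congr2 pair); last exact: rmorph_ext.
  by apply: (congr2 pair); [rewrite [RHS]fmap_chart|apply: rmorph_ext].
exists (quad t), h, (@Mor (Sp (quad t)) _ ap nat); split.
- move=> R; apply: bijective_of => [g g' /(congr1 sval) e|[[[y r] f] e]].
    apply: quad_ext; last exact: (congr1 snd e).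
    exact: chart_inj (congr1 fst (congr1 fst e)).
  have ey : sq y = chart 0 (f t) by rewrite [LHS](congr1 fst e) /= ex [LHS]fmap_chart.
  have [s es] := sq_in_chart ey.
  have e2 : s ^+ 2 = f t by apply: (@chart_inj _ 0); rewrite -sq_chart -es.
  have [|g [gr gh]] := @quad_lift _ t R f s; first by rewrite -expr2.
  exists g; apply: sig_ext; rewrite /= gh gr -es.
  by apply: (congr2 pair) => //; apply: (congr2 pair) => //; rewrite [RHS](congr1 snd e).
- by move=> R g.
exact: quad_free.
Qed.

Lemma sq_one_point_above : @one_point_above k (P1_pointed k) (P1_pointed k) sq_mor.
Proof.
move=> K x; apply: iff_trans (image_infty _) _.
apply: iff_trans _ (iff_sym (image_infty _)).
apply: iff_trans (not_in_chart _ _) _; apply: iff_trans _ (iff_sym (not_in_chart _ _)).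
split=> hn [s es]; apply: hn; last exact: sq_in_chart es.
by exists (s ^+ 2); rewrite /= es sq_chart.
Qed.

Lemma sq_pullback :
  @is_pullback_of_functions k (P1_pointed k) (P1_pointed k) sq_mor sqX.
Proof.
move=> a R x hx hpx /=.
rewrite [in RHS](@affine_coord_unique _ _ _ (rcomp (affine_coord (exist _ x hx)) sqX)) //.
by rewrite -sq_chart_mor -affine_coordP.
Qed.

End Squaring.

(** * Modules over F_3[T] with underlying group G_a *)

(* F_3{tau} is the commutative polynomial ring F_3[tau], and an element of it acts
   on every F_3-algebra, tau being the map t |-> t^3. *)
Section Frobenius.
Variables (R : comPzRingType) (rho : {rmorphism F3 -> R}).

Lemma mulr3n (x : R) : x *+ 3 = 0.
Proof.
rewrite -mulr_natr -(rmorph_nat rho) (_ : 3%:R = 0) ?rmorph0 ?mulr0 //.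
exact: val_inj.
Qed.

Lemma cubeD (x y : R) : (x + y) ^+ 3 = x ^+ 3 + y ^+ 3.
Proof.
transitivity (x ^+ 3 + y ^+ 3 + (x * y * (x + y)) *+ 3); first ring.
by rewrite mulr3n addr0.
Qed.

Definition tau_act (t : R) (P : {poly F3}) : R := wsum rho (fun i => t ^+ (3 ^ i)) P.
HB.instance Definition _ t :=
  GRing.isZmodMorphism.Build {poly F3} R (tau_act t) (wsum_zmod rho _).

Lemma tau_actMX t P : tau_act t (P * 'X) = tau_act (t ^+ 3) P.
Proof.
by rewrite [LHS]wsumMX; apply: eq_bigr => i _; rewrite -exprM expnS.
Qed.

Lemma tau_actC t c : tau_act t c%:P = rho c * t.
Proof. by rewrite [LHS]wsumC expn0 expr1. Qed.

Lemma tau_act_cons t P c : tau_act t (P * 'X + c%:P) = tau_act (t ^+ 3) P + rho c * t.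
Proof. by rewrite raddfD /= tau_actMX tau_actC. Qed.

Lemma tau_actD t t' P : tau_act (t + t') P = tau_act t P + tau_act t' P.
Proof.
elim/poly_ind: P t t' => [|P c IH] t t'; first by rewrite !raddf0 addr0.
by rewrite !tau_act_cons cubeD IH; ring.
Qed.

Lemma tau_act0 P : tau_act 0 P = 0.
Proof.
by apply: (addrI (tau_act 0 P)); rewrite -tau_actD !addr0.
Qed.

Lemma tau_actN t P : tau_act (- t) P = - tau_act t P.
Proof. by apply: (addrI (tau_act t P)); rewrite -tau_actD !subrr tau_act0. Qed.

Lemma F3_cube (c : F3) : c ^+ 3 = c.
Proof. by case: c => [[|[|[|//]]] hc]; apply: val_inj. Qed.

Lemma tau_act_cube t P : tau_act t P ^+ 3 = tau_act (t ^+ 3) P.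
Proof.
elim/poly_ind: P t => [|P c IH] t; first by rewrite !raddf0 expr0n.
rewrite !tau_act_cons cubeD IH; congr (_ + _).
by rewrite exprMn -[in RHS](F3_cube c) rmorphXn.
Qed.

(** Products of polynomials act as compositions because cubing is additive and fixes the
    coefficients. *)
Lemma tau_actM t P Q : tau_act t (P * Q) = tau_act (tau_act t Q) P.
Proof.
elim/poly_ind: P t => [|P c IH] t; first by rewrite mul0r !raddf0.
rewrite tau_act_cons tau_act_cube -IH -tau_actMX mulrDl raddfD /= mulrAC.
by rewrite [tau_act t (c%:P * Q)]wsumCM.
Qed.

End Frobenius.

Lemma rmorph_tau_act (R S : comPzRingType) (f : {rmorphism R -> S})
    (rho : {rmorphism F3 -> R}) t P :
  f (tau_act rho t P) = tau_act (rcomp f rho) (f t) P.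
Proof.
rewrite rmorph_sum; apply: eq_bigr => i _.
by rewrite rmorphM rmorphXn.
Qed.

(** * Drinfeld modules on the additive group *)

Section AdditiveGroup.
Variables (S : functor).

Program Definition Ga : comm_group S :=
  @CommGroup S (prod_fun A1 S)
    (@Mor (prod_fun A1 S) S (fun R x => x.2) (fun _ _ _ _ => erefl))
    (fun R x y e => (x.1 + y.1, x.2))
    (@Mor S (prod_fun A1 S) (fun R s => (0, s)) _)
    (@Mor (prod_fun A1 S) (prod_fun A1 S) (fun R x => (- x.1, x.2)) _)
    _ _ _ _ _ _ _ _.
Next Obligation. by move=> R T f s; rewrite /= rmorph0. Qed.
Next Obligation. by move=> R T f x; rewrite /= rmorphN. Qed.
Next Obligation. by move=> R T f x y e e'; rewrite /= rmorphD. Qed.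
Next Obligation. by []. Qed.
Next Obligation. by []. Qed.
Next Obligation. by []. Qed.
Next Obligation. by move=> R x y z * /=; rewrite addrA. Qed.
Next Obligation. by move=> R [x s] [y s'] /= e _; rewrite addrC e. Qed.
Next Obligation. by move=> R [x s] /= _; rewrite add0r. Qed.
Next Obligation. by move=> R [x s] /= _; rewrite addNr. Qed.

Variables (sigma : mor S (Sp F3)) (q : {poly F3}).

(** The module with phi_T = q(tau); by commutativity of F_3{tau}, phi_a is a(q(tau)). *)
Program Definition tau_module : amodule {poly F3} S :=
  @AModule {poly F3} S Ga
    (fun a => @Mor Ga Ga
       (fun R x => (tau_act (sigma R x.2) x.1 (a \Po q), x.2)) _) _ _ _ _.
Next Obligation.
move=> a R T f [t s]; apply: (congr2 pair) => //=.
by rewrite rmorph_tau_act app_nat.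
Qed.
Next Obligation.
move=> a; split=> // R [x s] [y s'] /= e e'; congr pair.
by rewrite -e tau_actD.
Qed.
Next Obligation.
by move=> R [x s]; rewrite /= comp_polyC tau_actC rmorph1 mul1r.
Qed.
Next Obligation.
by move=> a b R [x s]; rewrite /= rmorphM tau_actM.
Qed.
Next Obligation.
by move=> a b R [x s] /= e; rewrite rmorphD raddfD.
Qed.

End AdditiveGroup.

Lemma ev_comp (K : comNzRingType) (p G : {poly K}) : ev (@polyC K) G p = p \Po G.
Proof.
elim/poly_ind: p => [|p c IH]; first by rewrite rmorph0 comp_poly0.
by rewrite rmorphD rmorphM evX evC IH comp_polyD comp_polyM comp_polyX comp_polyC.
Qed.

(* psi is given by an additive polynomial with a right inverse for composition,
   which therefore has degree 1. *)
Lemma additive_group_auto (K : fieldType)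
    (psi : forall R : comPzRingType, {rmorphism K -> R} -> R -> R) :
  (forall (R S : comPzRingType) (g : {rmorphism R -> S}) rho t,
     g (psi R rho t) = psi S (rcomp g rho) (g t)) ->
  (forall R rho t t', psi R rho (t + t') = psi R rho t + psi R rho t') ->
  (forall R rho t', exists t, psi R rho t = t') ->
  exists2 a, a != 0 & forall R rho t, psi R rho t = rho a * t.
Proof.
move=> nat add surj.
pose P := psi {poly K} (@polyC K) 'X.
have psiE (R : comPzRingType) (rho : {rmorphism K -> R}) t : psi R rho t = ev rho t P.
  rewrite nat evX; congr psi.
  by apply: rmorph_ext => c; rewrite /= [RHS]evC.
(* [G] is a preimage of the universal element, so P(G(X)) = X and the degrees of P and G multiply to
   1. *)
have [G] := surj {poly K} (@polyC K) 'X; rewrite psiE ev_comp => PG.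
have := size_comp_poly P G; rewrite PG size_polyX => /esym/eqP.
rewrite muln_eq1 => /andP[/eqP sP _].
have sP2 : size P = 2 by case: (size P) sP => //= n ->.
have eP : P = (P`_1)%:P * 'X + (P`_0)%:P.
  apply/polyP => -[|[|i]]; rewrite !coefD coefMX !coefC /= ?add0r ?addr0 //.
  by rewrite nth_default // sP2.
have P0 : P`_0 = 0.
  apply: (addrI (psi K (rid K) 0)); rewrite addr0 -[in RHS](addr0 0) add.
  congr (_ + _).
  by rewrite psiE eP rmorphD rmorphM evX mulr0 add0r evC coefD coefMX add0r coefC.
exists P`_1; first by have := lead_coef_eq0 P; rewrite lead_coefE sP2 /= -size_poly_eq0 sP2 => ->.
by move=> R rho t; rewrite psiE {1}eP P0 rmorphD rmorphM evX !evC rmorph0 addr0.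
Qed.

Local Notation A := {poly F3}.
Local Notation P1F3 := (P1_pointed F3).

Definition origin : {rmorphism A -> F3} := ev (rid F3) 0.

Lemma origin_comp (q a : A) : q`_0 = 0 -> (a \Po q)`_0 = origin a.
Proof.
move=> q0; elim/poly_ind: a => [|p c _]; first by rewrite comp_poly0 rmorph0 coef0.
rewrite comp_polyD comp_polyM comp_polyX comp_polyC coefD coef0M q0 mulr0 add0r coefC.
by rewrite rmorphD rmorphM [origin 'X]evX mulr0 add0r [RHS]evC.
Qed.

Section Point.
Variables (K : fieldType) (iota : {rmorphism F3 -> K}).

Definition base : mor (Sp K) (Sp F3) := Sp_mor iota.
Definition char0 : mor (Sp K) (Sp A) := Sp_mor (rcomp iota origin).

Lemma Ga_scheme : is_scheme (Ga (Sp K)).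
Proof.
pose ap (R : comPzRingType) (f : Sp {poly K} R) : Ga (Sp K) R :=
  (f 'X, rcomp f (@polyC K)).
have nat (R S : comPzRingType) (f : {rmorphism R -> S}) (x : Sp {poly K} R) :
    ap S (fmap (Sp {poly K}) f x) = fmap (Ga (Sp K)) f (ap R x).
  by apply: (congr2 pair) => //; apply: rmorph_ext.
apply: (@affine_scheme _ {poly K} (Mor nat)).
  exact: prod_sheaf A1_sheaf (@Sp_sheaf K).
move=> R; apply: bijective_of => [f g e|[t rho]].
  apply: poly_rmorph_ext => [|c]; first exact: (congr1 fst e).
  exact: (congr1 (fun h : {rmorphism _ -> _} => h c) (congr1 snd e)).
exists (ev rho t); apply: (congr2 pair); first exact: evX.
by apply: rmorph_ext => c; apply: evC.
Qed.

(** A nonempty open subscheme of [Sp K] is everything, by [open_descent] applied to the identity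
    point. *)
Lemma open_in_point (B : comPzRingType) (u : mor (Sp B) (Sp K)) :
  open_immersion u -> (1 : B) <> 0 ->
  exists g : {rmorphism B -> K},
    rcomp g (u B (rid B)) = rid K /\ rcomp (u B (rid B)) g = rid B.
Proof.
move=> [inj op] B1; pose v := u B (rid B).
have uE (R : comPzRingType) (f : {rmorphism B -> R}) : u R f = rcomp f v by exact: point_fmap.
have [g eg] : image u (rid K).
  apply: (open_descent (f := v) op B1); exists (rid B).
  by apply: rmorph_ext.
exists g; split; first by rewrite -uE.
apply: inj; rewrite uE; apply: rmorph_ext => c; rewrite /= -/v.
congr (v _); rewrite uE in eg.
exact: (congr1 (fun f : {rmorphism _ -> _} => f c) eg).
Qed.

Variables (q : A) (r : nat).
Hypotheses (q0 : q`_0 = 0) (sq : size q = r.+1) (r0 : (0 < r)%N).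

(** An affine open of [Sp K] is empty or all of it, and in the second case any coordinate is a
    scalar [al] times the standard one. Conjugation by [al] preserves the constant coefficient and
    the degree, which is [r] times deg a. *)
Lemma tau_module_drinfeld : is_drinfeld (C := P1F3) r char0 (tau_module base q).
Proof.
split; first exact: Ga_scheme.
- exists unit, (fun=> Sp K), (fun=> id_mor (Sp K)); split.
    split=> [_|L x]; last by exists tt; exists x.
    exact/iso_open_immersion/id_iso.
  move=> _; exists (@Mor (pull (id_mor (Sp K)) (tau_module base q)) A1
    (fun R x => (sval x).1.1) (fun _ _ _ _ => erefl)); split=> //.
    move=> l R [[[t s] s'] /= e]; rewrite comp_polyC tau_actC.
    by rewrite [origin _]evC -e.
  move=> R s t; exists (exist (fun z : Ga (Sp K) R * Sp K R => z.1.2 = z.2) ((t, s), s) erefl).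
  split=> // -[[[t' s'] s''] /= e'] [/= e1 e2]; apply: sig_ext => /=.
  by rewrite e' e1 e2.
move=> B u psi hu [hadd _ hbij] a a0.
have sa : size (a \Po q) = (r * (size a).-1).+1.
  have c0 : a \Po q != 0.
    rewrite comp_poly_eq0 ?a0 // sq ltnS //.
  by rewrite -[LHS]prednK ?size_poly_gt0 // size_comp_poly sq mulnC.
have ordE : (r * (size a).-1)%:Z = - (r%:Z * ord (p := P1F3) a * (deg P1F3)%:Z).
  have : (0 < size a)%N by rewrite size_poly_gt0.
  rewrite /= /P1_ord; case: (size a) => // n _ /=.
  by rewrite PoszM -[n.+1]addn1 PoszD; ring.
pose v := u B (rid B).
have uE (R : comPzRingType) (f : {rmorphism B -> R}) : u R f = rcomp f v by exact: point_fmap.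
(* Over the empty open set every equation holds, and 0 is a unit. *)
have [B0|B1] := EM ((1 : B) = 0).
  have z (x y : B) : x = y by rewrite -[x]mul1r -[y]mul1r B0 !mul0r.
  exists 0%N, (fun=> 0), (r * (size a).-1)%N; split=> //.
    move=> R x; rewrite big_ord0; set w := psi R _.
    by rewrite -[w]mul1r -(rmorph1 (gpr (pull u (tau_module base q)) R x)) B0 rmorph0 mul0r.
  by split=> [|i _]; [exists 0|exists 1%N].
have [g [gv vg]] := open_in_point hu B1.
have hgv (R : comPzRingType) (f : {rmorphism K -> R}) : f = u R (rcomp f g).
  rewrite uE; apply: rmorph_ext => c; rewrite /= -/v.
  by rewrite [g (v c)](congr1 (fun h : {rmorphism _ -> _} => h c) gv).
pose pt (R : comPzRingType) (f : {rmorphism K -> R}) (t : R) : pull u (tau_module base q) R :=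
  exist (fun z : Ga (Sp K) R * Sp B R => z.1.2 = u R z.2) ((t, f), rcomp f g) (hgv R f).
pose Psi (R : comPzRingType) (f : {rmorphism K -> R}) (t : R) := psi R (pt R f t).
have [|||al al0 PsiE] := @additive_group_auto K Psi.
- move=> R S h f t; apply: etrans (esym (app_nat psi h (pt R f t))) _; congr (psi S _).
  by apply: sig_ext; apply: (congr2 pair) => //; apply: rmorph_ext.
- move=> R f t t'; rewrite /Psi -hadd //=; congr (psi R _).
  exact: sig_ext.
- move=> R f t'; have [x [[/= ex1 ex2] _]] := hbij R (rcomp f g) t'.
  case: x ex1 ex2 => [[[t f'] h] /= e] eh ex2; exists t; rewrite -ex2; congr (psi R _).
  by apply: sig_ext; rewrite /= e eh -hgv.
have psiE (R : comPzRingType) (x : pull u (tau_module base q) R) :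
    psi R x = (sval x).2 (v al) * (sval x).1.1.
  case: x => [[[t f] h] /= e]; have ef : f = rcomp h v by rewrite -uE.
  have eh : h = rcomp f g.
    rewrite ef; apply: rmorph_ext => c /=.
    by rewrite [v (g c)](congr1 (fun h : {rmorphism _ -> _} => h c) vg).
  rewrite -[h (v al)]/(rcomp h v al) -ef -PsiE; congr (psi R _).
  by apply: sig_ext; rewrite /= eh.
(* From al c tau^i al^-1 = al c al^(-3^i) tau^i, transported from [K] to [B] by [v]. *)
exists (size (a \Po q)), (fun i => v (al * iota (a \Po q)`_i * al^-1 ^+ (3 ^ i))),
  (r * (size a).-1)%N; split=> //.
- by move=> i hi; rewrite nth_default // rmorph0 mulr0 mul0r rmorph0.
- move=> R x; rewrite !psiE card_Fp //; case: x => [[[t f] h] /= e].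
  have ef : f = rcomp h v by rewrite -uE.
  rewrite /tau_act /wsum mulr_sumr; apply: eq_bigr => i _.
  rewrite ef /= exprMn -!rmorphXn !rmorphM !rmorphXn.
  have ali : h (v al^-1) * h (v al) = 1.
    by rewrite -!rmorphM mulVf // !rmorph1.
  transitivity (h (v al) * (h (v (iota (a \Po q)`_i)) * t ^+ (3 ^ i)) *
     (h (v al^-1) * h (v al)) ^+ (3 ^ i)); first by rewrite ali expr1n mulr1.
  by rewrite exprMn; ring.
- by rewrite /= expn0 expr1 origin_comp // mulrAC mulfV ?mul1r.
split=> [|i hi]; last first.
  by exists 1%N; rewrite nth_default ?sa // rmorph0 mulr0 mul0r rmorph0.
set d := al * _ * _; have u0 : d != 0.
  rewrite !mulf_neq0 ?expf_neq0 ?invr_neq0 // fmorph_eq0.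
  have -> : (r * (size a).-1)%N = (size (a \Po q)).-1 by rewrite sa.
  by rewrite -lead_coefE lead_coef_eq0 -size_poly_eq0 sa.
by exists (v d^-1); rewrite -rmorphM mulfV // rmorph1.
Qed.

End Point.

(** * The counterexample *)

Local Notation sqX := (comp_poly 'X^2 : {rmorphism A -> A}).

Section TauModulePullback.
Variables (S S' : functor) (f : mor S' S).
Variables (sigma : mor S (Sp F3)) (sigma' : mor S' (Sp F3)).
Hypothesis sigma_f : mor_eq (comp sigma f) sigma'.

Lemma pull_tau_module_restrict (pis : {rmorphism A -> A}) (q q' : A) :
  (forall a, a \Po q = pis a \Po q') ->
  amodule_iso (pull f (tau_module sigma q)) (restrict pis (tau_module sigma' q')).
Proof.
move=> eq.
exists (@Mor (pull f (tau_module sigma q)) (restrict pis (tau_module sigma' q'))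
  (fun R x => ((sval x).1.1, (sval x).2)) (fun _ _ _ _ => erefl)); split.
- by split.
- move=> R; apply: bijective_of => [[[[t s] s'] /= e] [[[t1 s1] s1'] /= e1] [et es]|[t s]].
    by apply: sig_ext; rewrite /= e e1 et es.
  by exists (exist (fun z : Ga S R * S' R => z.1.2 = f R z.2) ((t, f R s), s) erefl).
move=> a R [[[t s] s'] /= e]; apply: (congr2 pair) => //=.
by rewrite eq e [sigma R _]sigma_f.
Qed.

Lemma pull_tau_module (q : A) :
  amodule_iso (tau_module sigma' q) (pull f (tau_module sigma q)).
Proof.
pose ap (R : comPzRingType) (x : tau_module sigma' q R) : pull f (tau_module sigma q) R :=
  exist (fun z : Ga S R * S' R => z.1.2 = f R z.2) ((x.1, f R x.2), x.2) erefl.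
have nat (R T : comPzRingType) (h : {rmorphism R -> T}) (x : tau_module sigma' q R) :
    ap T (fmap (tau_module sigma' q) h x) = fmap (pull f (tau_module sigma q)) h (ap R x).
  by apply: sig_ext; rewrite /= app_nat.
exists (Mor nat); split.
- by split=> // R x y e e'; apply: sig_ext.
- move=> R; apply: bijective_of => [[t s] [t' s'] /(congr1 sval) [-> _ ->] //|].
  move=> [[[t s] s'] /= e]; exists (t, s'); apply: sig_ext; by rewrite /= e.
move=> a R [t s]; apply: sig_ext; rewrite /= -[sigma' R s]sigma_f.
by [].
Qed.

End TauModulePullback.

(** Since i^3 = -i, multiplication by i intertwines tau with -tau. *)
Lemma tau_actNX (R : comPzRingType) (rho : {rmorphism F3 -> R}) (i t : R) (a : A) :
  i * i = -1 ->
  tau_act rho (i * t) (a \Po (- 'X)) = i * tau_act rho t (a \Po 'X).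
Proof.
move=> ii; elim/poly_ind: a t => [|p c IH] t.
  by rewrite !comp_poly0 !raddf0 mulr0.
rewrite !comp_polyD !comp_polyM !comp_polyX !comp_polyC mulrN !raddfD raddfN /=.
rewrite !tau_actMX !tau_actC mulrDr -IH -tau_actN; congr (tau_act _ _ _ + _); last by ring.
have -> : (i * t) ^+ 3 = (i * i) * i * t ^+ 3 by ring.
rewrite ii; ring.
Qed.

Lemma tau_module_twist (S : functor) (sigma : mor S (Sp F3)) (i : mor S A1) :
  (forall R s, i R s * i R s = -1) ->
  amodule_iso (tau_module sigma 'X) (tau_module sigma (- 'X)).
Proof.
move=> ii.
have nat (R T : comPzRingType) (h : {rmorphism R -> T}) (x : Ga S R) :
    (i T (fmap (Ga S) h x).2 * (fmap (Ga S) h x).1, (fmap (Ga S) h x).2) =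
    fmap (Ga S) h (i R x.2 * x.1, x.2).
  by apply: (congr2 pair) => //=; rewrite app_nat rmorphM.
exists (@Mor (tau_module sigma 'X) (tau_module sigma (- 'X))
  (fun R x => (i R x.2 * x.1, x.2)) nat); split.
- split=> // R [t s] [t' s'] /= e e'; apply: (congr2 pair) => //=.
  by rewrite -e mulrDr.
- move=> R; exists (fun x => (- i R x.2 * x.1, x.2)) => -[t s] /=.
    by rewrite mulrA mulNr ii opprK mul1r.
  by rewrite mulrA mulrN ii opprK mul1r.
by move=> a R [t s]; apply: (congr2 pair) => //=; apply: tau_actNX.
Qed.

(** An isomorphism is a nonzero scalar [al] of F_3. On F_3-points tau is the identity, so
    compatibility with T at the point 1 reads -al = al. *)
Lemma tau_module_not_iso :
  ~ amodule_iso (tau_module (base (rid F3)) 'X) (tau_module (base (rid F3)) (- 'X)).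
Proof.
case=> eps [[epr eadd] ebij eact].
pose psi (R : comPzRingType) (rho : {rmorphism F3 -> R}) (t : R) : R := (eps R (t, rho)).1.
have epsE (R : comPzRingType) (rho : {rmorphism F3 -> R}) (t : R) :
    eps R (t, rho) = (psi R rho t, rho).
  by have := epr R (t, rho); rewrite /psi /=; case: (eps R _) => x y /= ->.
have [|||al al0 psiE] := @additive_group_auto F3 psi.
- move=> R S g rho t; exact: (congr1 fst (esym (app_nat eps g (t, rho)))).
- move=> R rho t t'.
  have e' : gpr (tau_module (base (rid F3)) (- 'X)) R (eps R (t, rho)) =
            gpr (tau_module (base (rid F3)) (- 'X)) R (eps R (t', rho)).
    by rewrite !epsE.
  exact: (congr1 fst (eadd R (t, rho) (t', rho) erefl e')).
- move=> R rho t'; have [g _ gK] := ebij R.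
  have := gK (t', rho); case: (g _) => t rho'; rewrite epsE => -[<- <-].
  by exists t.
have tauX (rho : {rmorphism F3 -> F3}) t : tau_act rho t 'X = t.
  by rewrite -['X]mul1r tau_actMX tau_actC F3_cube rmorph1 mul1r.
have tauNX (rho : {rmorphism F3 -> F3}) t : tau_act rho t (- 'X) = - t.
  by rewrite [LHS]raddfN /= tauX.
have := congr1 fst (eact 'X F3 (1, rid F3)).
rewrite /= [eps F3 (1, _)]epsE [eps F3 (_, _)]epsE /= !psiE !comp_polyX.
rewrite tauX tauNX mulr1 => {psiE}.
by case: al al0 => [[|[|[|//]]] h].
Qed.

Section Fibre.
Variables (K : fieldType) (iota : {rmorphism F3 -> K}).

Definition point_over_comm :
  mor_eq (comp (Sp_mor sqX) (char0 iota)) (comp (char0 (rid F3)) (base iota)).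
Proof.
move=> R f; apply: poly_rmorph_ext => [|c].
  by rewrite /= comp_polyX !rmorphXn [origin 'X]evX [peval _ _ 'X]evX !rmorph0 expr0n.
by rewrite [LHS](_ : _ = f (iota (origin (c%:P \Po 'X^2)))) // comp_polyC.
Qed.

Definition point_over : @scheme_over F3 P1F3 P1F3 sqX (Sp F3) (char0 (rid F3)) :=
  @SchemeOver F3 P1F3 P1F3 sqX (Sp F3) (char0 (rid F3)) (Sp K) (@Sp_scheme K)
    (char0 iota) (base iota) point_over_comm.

Lemma comp_sqX (q : A) (a : A) : q ^+ 2 = 'X^2 -> a \Po 'X^2 = sqX a \Po q.
Proof.
by move=> q2; rewrite [RHS]/= -comp_polyA rmorphXn /= comp_polyX q2.
Qed.

(** The condition [q2] says phi'_(T^2) = tau^2; it puts the module phi'_T = q(tau) in the fibre over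
    tau^2. *)
Definition tau_object (q : A) (q0 : q`_0 = 0) (sq : size q = 2) (q2 : q ^+ 2 = 'X^2) :
  @fiber_object F3 P1F3 P1F3 sqX 1 (Sp F3) (char0 (rid F3))
    (tau_module (base (rid F3)) 'X^2) point_over :=
  @FiberObject F3 P1F3 P1F3 sqX 1 (Sp F3) (char0 (rid F3)) (tau_module (base (rid F3)) 'X^2)
    point_over (tau_module (base iota) q)
    (tau_module_drinfeld iota q0 sq isT)
    (pull_tau_module_restrict (fun R f => erefl) (fun a => comp_sqX a q2)).

End Fibre.

Lemma size_NX : size (- 'X : A) = 2.
Proof. by rewrite size_polyN size_polyX. Qed.

Lemma sqr_NX : (- 'X : A) ^+ 2 = 'X^2.
Proof. by rewrite sqrrN. Qed.

Lemma coef0_X : ('X : A)`_0 = 0.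
Proof. by rewrite coefX. Qed.

Lemma coef0_NX : (- 'X : A)`_0 = 0.
Proof. by rewrite coefN coefX oppr0. Qed.

Definition plus_object (K : fieldType) (iota : {rmorphism F3 -> K}) :=
  tau_object iota coef0_X (size_polyX _) erefl.
Definition minus_object (K : fieldType) (iota : {rmorphism F3 -> K}) :=
  tau_object iota coef0_NX size_NX sqr_NX.

(** Any field-valued point of F_3[s]/(s^2 + 1) provides a square root of -1, without identifying
    this ring as a field. *)
Lemma adjoin_i : exists (K : fieldType) (iota : {rmorphism F3 -> K}) (i : K), i * i = -1.
Proof.
have [|K [f _]] := @field_point (quad (-1 : F3)).
  by move=> /(congr1 fst) /eqP; rewrite oner_eq0.
exists K, (rcomp f (quad_const (-1))), (f (qroot (-1))).
rewrite -rmorphM qroot2; exact: (rmorphN1 (rcomp f (quad_const (-1 : F3)))).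
Qed.

Lemma not_representable :
  ~ @fiber_representable F3 P1F3 P1F3 sqX 1 (Sp F3) (char0 (rid F3))
      (tau_module (base (rid F3)) 'X^2).
Proof.
case=> X [theta [over inj surj nat]].
have [K [iota [i ii]]] := adjoin_i.
pose g : mor (point_over iota) (point_over (rid F3)) := base iota.
have over_g : is_over g.
  by split=> R f; apply: rmorph_ext.
have base_g : mor_eq (comp (base (rid F3)) (base iota)) (base iota).
  by move=> R f; apply: rmorph_ext.
have nat_plus := nat _ _ g (plus_object (rid F3)) (plus_object iota) over_g
  (pull_tau_module base_g 'X).
have nat_minus := nat _ _ g (minus_object (rid F3)) (minus_object iota) over_g
  (pull_tau_module base_g (- 'X)).
pose j : mor (Sp K) A1 := @Mor (Sp K) A1 (fun R f => f i) (fun _ _ _ _ => erefl).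
have twist : amodule_iso (plus_object iota) (minus_object iota).
  apply: (@tau_module_twist _ (base iota) j) => R f.
  by rewrite /= -rmorphM ii rmorphN1.
have /inj eK := twist.
apply: tau_module_not_iso.
have : amodule_iso (plus_object (rid F3)) (minus_object (rid F3)); last by [].
apply/inj => R f.
(* By Yoneda it suffices to compare the images of the identity point, which are two elements of
   X(F_3). *)
rewrite [LHS]point_fmap [RHS]point_fmap; congr (fmap X f _).
have K1 : (1 : K) <> 0 by apply/eqP; rewrite oner_eq0.
apply: (scheme_points_inj (f := iota) (tot_scheme X) K1).
rewrite -!app_nat.
have <- : g K (rid K) = fmap (Sp F3) iota (rid F3) by apply: rmorph_ext.
(* Over [K] both points are the classes of the pulled back objects, which [twist] identifies. *)
exact: etrans (esym (nat_plus K (rid K))) (etrans (eK K (rid K)) (nat_minus K (rid K))).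
Qed.

Theorem theorem2p1 :
  exists (k : finFieldType) (C C' : pointed_curve k) (pi : mor C' C) (n : nat)
    (pis : {rmorphism cring C -> cring C'}) (r' : nat),
    [/\ over_base pi /\ finite_mor pi,
        degree_is pi n,
        one_point_above pi,
        is_pullback_of_functions pi pis
      & (0 < r')%N /\ ~ relatively_representable pis r' n].
Proof.
exists F3, P1F3, P1F3, (sq_mor F3), 2, sqX, 1%N; split.
- by split; [exact: sq_over_base|exact: sq_finite].
- exact: sq_degree.
- exact: sq_one_point_above.
- exact: sq_pullback.
split=> // rr; apply: not_representable; apply: rr; first exact: Sp_scheme.
(* The required rank 2 * 1 is the degree of tau^2 in tau. *)
apply: (tau_module_drinfeld (rid F3)) => //; first by rewrite coefXn.
by rewrite size_polyXn.
Qed.
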